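(* Let $\{T_\epsilon\}_{\epsilon\in(0,1]}$ be a family of functions $T_\epsilon\in C^2(\mathbb{R}^3;(0,\infty))$ with $\sup_\epsilon\sup_{\mathbf{x}}|\ln T_\epsilon(\mathbf{x})|<\infty$, and suppose there exist $r_0>0$ and $0<C<\mu/\lambda$ such that $|\nabla\ln T_\epsilon(\mathbf{x})|<C$ for all $|\mathbf{x}|>r_0$ and all $\epsilon\in(0,1]$. Let $\pi_\epsilon$ be the probability measure with density $\rho_\epsilon$ proportional to $T_\epsilon\exp(2R_\epsilon)$, and assume $\pi_\epsilon$ is an invariant measure of the limiting Nelson diffusion, i.e. $\nabla\cdot\big(\frac{\epsilon^2}{2}\nabla\rho_\epsilon-\mathbf{b}\rho_\epsilon\big)=0$ in the sense of distributions. Then there is a constant $\gamma>0$, depending only on $\lambda,\mu,e,C,r_0$ and $\sup_{\epsilon,\mathbf{x}}|\ln T_\epsilon|$, such that for every $\epsilon\in(0,1]$ $$\operatorname{gap}(\mathcal{G})\ge\exp(-\gamma/\epsilon^2).$$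
   Context: Fix $\mu>0$, $\lambda>0$, $e\in(0,1)$. For $\mathbf{x}=(x,y,z)\in\mathbb{R}^3$ let $\nu(\mathbf{x})=\frac{\mu}{\lambda^2}\big(|\mathbf{x}|-\frac{x}{e}-\frac{\mathrm{i}y\sqrt{1-e^2}}{e}\big)$, $\sqrt{\cdot}$ the principal branch of the complex square root, $N=\{0\}\cup\{\mathbf{x}:y=0,\ \nu(\mathbf{x})\in[0,4]\}$ (Lebesgue-null), and for $\epsilon>0$ on $\mathbb{R}^3\setminus N$ $$R_\epsilon(\mathbf{x})=\frac{\lambda}{\epsilon^2}\Big[\ln|\nu|+2\ln\big|1+\sqrt{1-4/\nu}\big|-\frac{\mu|\mathbf{x}|}{\lambda^2}+\tfrac12\operatorname{Re}\big(\nu(1-\sqrt{1-4/\nu})\big)\Big].$$ Drift of the limiting Nelson diffusion: with $$\mathbf{Z}(\mathbf{x})=\frac{\mathrm{i}\mu}{2\lambda}\Big(1+\sqrt{1-\tfrac4\nu}\Big)\frac{\mathbf{x}}{|\mathbf{x}|}+\frac{\mu}{2\lambda e}\Big(1-\sqrt{1-\tfrac4\nu}\Big)\big(\mathrm{i},-\sqrt{1-e^2},0\big),$$ set $\mathbf{b}=\operatorname{Re}\mathbf{Z}-\operatorname{Im}\mathbf{Z}$ (componentwise; note $\operatorname{Im}\mathbf{Z}=-\epsilon^2\nabla R_\epsilon$). The limiting Nelson diffusion is $d\mathbf{X}_\epsilon=\mathbf{b}(\mathbf{X}_\epsilon)\,dt+\epsilon\,d\mathbf{B}(t)$ with $\mathbf{B}$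 a standard 3-dimensional Brownian motion, and its generator is $\mathcal{G}=\frac{\epsilon^2}{2}\Delta+\mathbf{b}\cdot\nabla$. The spectral gap is $$\operatorname{gap}(\mathcal{G})=\inf\Big\{-\int f\,\mathcal{G}f\,d\pi_\epsilon:\ f\in C_c^\infty(\mathbb{R}^3),\ \int f\,d\pi_\epsilon=0,\ \int f^2\,d\pi_\epsilon=1\Big\}.$$ *)

(* Defs.v *)
From HB Require Import structures.
From mathcomp Require Import all_boot all_order all_algebra.
From mathcomp Require Import all_classical all_reals all_analysis.
Set Implicit Arguments. Unset Strict Implicit. Unset Printing Implicit Defensive.
Import Order.TTheory GRing.Theory Num.Theory.
Import numFieldNormedType.Exports.
Local Open Scope classical_set_scope.
Local Open Scope ring_scope.

Section Defs.
Variable R : realType.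

Definition pt3 := ((R * R) * R)%type.
Definition mk3 (x y z : R) : pt3 := ((x, y), z).
Definition cx (p : pt3) : R := p.1.1.
Definition cy (p : pt3) : R := p.1.2.
Definition cz (p : pt3) : R := p.2.
Definition coord3 (p : pt3) (i : nat) : R :=
  match i with 0%N => cx p | 1%N => cy p | _ => cz p end.
Definition upd3 (p : pt3) (i : nat) (t : R) : pt3 :=
  match i with
  | 0%N => mk3 t (cy p) (cz p)
  | 1%N => mk3 (cx p) t (cz p)
  | _ => mk3 (cx p) (cy p) t end.
Definition norm3 (p : pt3) : R := Num.sqrt (cx p ^+ 2 + cy p ^+ 2 + cz p ^+ 2).

Definition leb3 := (((@lebesgue_measure R) \x (@lebesgue_measure R)) \x (@lebesgue_measure R))%E.

(* the i-th partial derivative of f at p (value; meaningful when it exists) *)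
Definition pdiff (i : nat) (f : pt3 -> R) (p : pt3) : R :=
  derive1 (fun t => f (upd3 p i t)) (coord3 p i).
Definition pdiff_exists (i : nat) (f : pt3 -> R) (p : pt3) : Prop :=
  derivable (fun t => f (upd3 p i t)) (coord3 p i) 1.
Fixpoint pdiffs (s : seq nat) (f : pt3 -> R) : pt3 -> R :=
  match s with [::] => f | i :: s' => pdiff i (pdiffs s' f) end.
Definition dir3 (i : nat) : bool := (i < 3)%N.
Definition Ck (k : nat) (f : pt3 -> R) : Prop :=
  (forall s : seq nat, all dir3 s -> (size s <= k)%N -> continuous (pdiffs s f)) /\
  (forall (s : seq nat) (i : nat), all dir3 s -> (size s < k)%N -> dir3 i ->
      forall p, pdiff_exists i (pdiffs s f) p).
Definition Cinf (f : pt3 -> R) : Prop := forall k, Ck k f.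
Definition compact_support (f : pt3 -> R) : Prop :=
  exists r : R, forall p, r < norm3 p -> f p = 0.
Definition Ccinf (f : pt3 -> R) : Prop := Cinf f /\ compact_support f.

Definition grad_norm (f : pt3 -> R) (p : pt3) : R :=
  Num.sqrt (pdiff 0 f p ^+ 2 + pdiff 1 f p ^+ 2 + pdiff 2 f p ^+ 2).
Definition laplacian (f : pt3 -> R) (p : pt3) : R :=
  pdiffs [:: 0; 0]%N f p + pdiffs [:: 1; 1]%N f p + pdiffs [:: 2; 2]%N f p.

Definition cplx := (R * R)%type.
Definition cRe (z : cplx) := z.1.
Definition cIm (z : cplx) := z.2.
Definition cadd (z w : cplx) : cplx := (z.1 + w.1, z.2 + w.2).
Definition csub (z w : cplx) : cplx := (z.1 - w.1, z.2 - w.2).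
Definition cmul (z w : cplx) : cplx := (z.1 * w.1 - z.2 * w.2, z.1 * w.2 + z.2 * w.1).
Definition cabs (z : cplx) : R := Num.sqrt (z.1 ^+ 2 + z.2 ^+ 2).
Definition cinv (z : cplx) : cplx :=
  (z.1 / (z.1 ^+ 2 + z.2 ^+ 2), - z.2 / (z.1 ^+ 2 + z.2 ^+ 2)).
Definition creal (a : R) : cplx := (a, 0).
Definition ci : cplx := (0, 1).
(* principal branch of the square root: Re >= 0, and for z on the negative
   real axis (Im z = 0, Re z < 0) the value i*sqrt|z| (argument in (-pi, pi]) *)
Definition csqrt (z : cplx) : cplx :=
  (Num.sqrt ((cabs z + z.1) / 2),
   (if z.2 < 0 then -1 else 1) * Num.sqrt ((cabs z - z.1) / 2)).

Variables (mu lam e : R).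

Definition nu (p : pt3) : cplx :=
  (mu / lam ^+ 2 * (norm3 p - cx p / e),
   - (mu / lam ^+ 2 * (cy p * Num.sqrt (1 - e ^+ 2) / e))).
Definition sq (p : pt3) : cplx := csqrt (csub (creal 1) (cmul (creal 4) (cinv (nu p)))).

(* exceptional (Lebesgue-null) set N *)
Definition Nset : set pt3 :=
  [set p | p = mk3 0 0 0 \/ (cy p = 0 /\ (nu p).2 = 0 /\ 0 <= (nu p).1 <= 4)].

(* R_eps (only relevant off N) *)
Definition Reps (eps : R) (p : pt3) : R :=
  lam / eps ^+ 2 *
  (ln (cabs (nu p)) + 2 * ln (cabs (cadd (creal 1) (sq p)))
   - mu * norm3 p / lam ^+ 2
   + 2^-1 * cRe (cmul (nu p) (csub (creal 1) (sq p)))).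

Definition Zc (i : nat) (p : pt3) : cplx :=
  let a := cmul (cmul ci (creal (mu / (2 * lam)))) (cadd (creal 1) (sq p)) in
  let c := cmul (creal (mu / (2 * lam * e))) (csub (creal 1) (sq p)) in
  let v : cplx := match i with 0%N => ci | 1%N => creal (- Num.sqrt (1 - e ^+ 2))
                              | _ => creal 0 end in
  cadd (cmul a (creal (coord3 p i / norm3 p))) (cmul c v).

Definition drift (i : nat) (p : pt3) : R := cRe (Zc i p) - cIm (Zc i p).
Definition drift_norm (p : pt3) : R :=
  Num.sqrt (drift 0 p ^+ 2 + drift 1 p ^+ 2 + drift 2 p ^+ 2).

Definition gen (eps : R) (f : pt3 -> R) (p : pt3) : R :=
  eps ^+ 2 / 2 * laplacian f p
  + (drift 0 p * pdiff 0 f p + drift 1 p * pdiff 1 f p + drift 2 p * pdiff 2 f p).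

Definition dens_un (eps : R) (T : pt3 -> R) (p : pt3) : R := T p * expR (2 * Reps eps p).
Definition Zconst (eps : R) (T : pt3 -> R) : \bar R :=
  (\int[leb3]_p (dens_un eps T p)%:E)%E.
Definition rho (eps : R) (T : pt3 -> R) (p : pt3) : R :=
  dens_un eps T p / fine (Zconst eps T).

Definition int_pi (eps : R) (T : pt3 -> R) (g : pt3 -> R) : \bar R :=
  (\int[leb3]_p (g p * rho eps T p)%:E)%E.

(* invariance of pi_eps in the sense of distributions:
   div(eps^2/2 grad rho - b rho) = 0, i.e. b rho is locally integrable and
   for every test function phi,
   -<eps^2/2 grad rho - b rho, grad phi> = int (eps^2/2 rho Lap phi + rho b.grad phi) = 0 *)
Definition pi_invariant (eps : R) (T : pt3 -> R) : Prop :=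
  (forall r : R, (\int[leb3]_(p in [set p | (norm3 p <= r)%R])
                   (drift_norm p * rho eps T p)%:E < +oo)%E) /\
  (forall phi, Ccinf phi ->
     (\int[leb3]_p (rho eps T p * (eps ^+ 2 / 2 * laplacian phi p)
       + rho eps T p * (drift 0 p * pdiff 0 phi p + drift 1 p * pdiff 1 phi p
                        + drift 2 p * pdiff 2 phi p))%:E)%E = 0%E).

Definition gap (eps : R) (T : pt3 -> R) : \bar R :=
  ereal_inf [set v | exists f, [/\ Ccinf f, int_pi eps T f = 0%E,
                                  int_pi eps T (fun p => (f p ^+ 2)%R) = 1%E &
                                  v = (- int_pi eps T (fun p => (f p * gen eps f p)%R))%E]].

End Defs.

(* Main.v *)
Require Import Defs.
From HB Require Import structures.
From mathcomp Require Import all_boot all_order all_algebra.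
From mathcomp Require Import all_classical all_reals all_analysis.
From mathcomp Require Import measurable_realfun ring lra.
Set Implicit Arguments. Unset Strict Implicit. Unset Printing Implicit Defensive.
Import Order.TTheory GRing.Theory Num.Theory.
Import numFieldNormedType.Exports.
Local Open Scope classical_set_scope.
Local Open Scope ring_scope.

(* Testing invariance on [f^2] turns [- int f (G f) dpi] into [eps^2/2 int |grad f|^2 dpi],
   whatever the antisymmetric part of the drift, so a Poincare inequality for [pi] with
   constant [exp(O(1/eps^2))] is enough.  Such a constant tolerates changing the density by
   factors [exp(O(1/eps^2))] (Holley-Stroock).  This removes [T] and replaces [2 R_eps] by [G/eps^2] with the smooth potential
   [G = lam ln q - (2 mu/lam) S], where [S = sqrt(1 + |x|^2)] and
   [q = 1 + (S - x/e)^2 + (1 - e^2) y^2/e^2] is comparable to [1 + |nu|^2]: indeed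
   [|nu| |1 + s|^2] is comparable to [1 + |nu|] and [nu (1 - s) = 4/(1 + s)] is bounded, for
   [s = sqrt(1 - 4/nu)].  Since [nu] is homogeneous of degree one, the radial derivative of
   [lam ln q] stays bounded by [O(1/S)], although [q] itself is not comparable to a radial
   function; so the outward field [x/S] is a Lyapunov field for the weight
   [w = exp(G/eps^2)].  Integrating [div (g^2 w x/S)] over large cubes, with [g = f - c],
   bounds [int g^2 w] by [int |grad f|^2 w] plus the integral of [g^2 w] over a fixed cube,
   where [w] is within [exp(O(1/eps^2))] of [1] and the Poincare inequality of the cube
   applies. *)

(** * Measurability and the Tonelli theorem on rectangles *)


(** [R_eps] is not smooth across [N], and the drift blows up where [nu] vanishes, so nothing can be
    differentiated against [rho]. All calculus is therefore done with the smooth weight; [rho]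
    enters only through measurability, two-sided bounds and the invariance identity. Cubes are used
    instead of balls because the divergence theorem on a cube reduces to the one-dimensional
    fundamental theorem and Tonelli. The function [g = f - c] has no compact support and no decay,
    so boundary terms survive at every size of the cube; it is their sign, not their smallness, that
    removes them. Write [n = 1/eps^2]. The Lyapunov argument costs only factors polynomial in [n];
    exponentials arise solely from comparing the weight with a constant on one fixed cube and from
    comparing [rho] with the weight. *)

Lemma continuous_pairat (T U V : topologicalType) (f : T -> U) (g : T -> V) x :
  {for x, continuous f} -> {for x, continuous g} ->
  {for x, continuous (fun y => (f y, g y))}.
Proof. move=> cf cg; exact: (cvg_pair cf cg). Qed.

Lemma continuous_cstat (T U : topologicalType) (a : U) (x : T) :
  {for x, continuous (fun _ : T => a)}.
Proof. exact: cvg_cst. Qed.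

Lemma continuous_idat (T : topologicalType) (x : T) : {for x, continuous (fun y : T => y)}.
Proof. exact: cvg_id. Qed.

Section Measurability.
Variable R : realType.

Lemma cvg_floor_grid (z : R) :
  ((Num.floor (z * n.+1%:R))%:~R / n.+1%:R : R) @[n --> \oo] --> z.
Proof.
apply/cvgrPdist_le => /= eps eps0; near=> n.
have n0 : (0 : R) < n.+1%:R by rewrite ltr0n.
have /andP[h1 h2] := mem_rg1_floor (z * n.+1%:R).
have -> : z - (Num.floor (z * n.+1%:R))%:~R / n.+1%:R =
   (z * n.+1%:R - (Num.floor (z * n.+1%:R))%:~R) / n.+1%:R.
  by rewrite mulrBl mulfK ?gt_eqF.
rewrite ger0_norm; last by rewrite divr_ge0 ?subr_ge0// ltW.
apply: (@le_trans _ _ (n.+1%:R^-1)).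
  rewrite ler_pdivrMr// mulVf ?gt_eqF//.
  by move: h2 => ?; lra.
apply: ltW.
near: n; exact: near_infty_natSinv_lt (PosNum eps0).
Unshelve. all: by end_near. Qed.

(** Rounding the last variable down to a grid of mesh [1/(n+1)] gives a function with countably many
    slabs, on each of which it depends on [y] alone and is measurable; continuity in the last
    variable gives convergence as the mesh shrinks. Adding one real coordinate at a time, this links
    continuity on the product space to the product sigma-algebra. *)
Lemma measurable_fun_caratheodory d (Y : measurableType d) (g : Y * R -> R) :
  (forall z, measurable_fun [set: Y] (fun y => g (y, z))) ->
  (forall y, continuous (fun z => g (y, z))) ->
  measurable_fun [set: Y * R] g.
Proof.
move=> mg cg.
pose h (n : nat) (p : Y * R) : R :=
  g (p.1, (Num.floor (p.2 * n.+1%:R))%:~R / n.+1%:R).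
apply: (measurable_fun_cvg (h := h)); last first.
  move=> [y z] _; rewrite /h /=.
  apply: (@cvg_comp _ _ _ (fun n : nat => (Num.floor (z * n.+1%:R))%:~R / n.+1%:R : R)
    (fun z' => g (y, z'))); [exact: cvg_floor_grid | exact: cg].
move=> n _ B mB; rewrite setTI.
have -> : h n @^-1` B = \bigcup_(k in [set: int])
   ([set p : Y * R | g (p.1, k%:~R / n.+1%:R) \in B] `&`
    [set p : Y * R | (k%:~R <= p.2 * n.+1%:R) && (p.2 * n.+1%:R < (k + 1)%:~R)]).
  apply/seteqP; split => [[y z] /= Bh|[y z] [k _] /= [gB kz]].
    exists (Num.floor (z * n.+1%:R)) => //=; split; first exact: mem_set.
    exact: floor_itv.
  rewrite /h /=; have -> : Num.floor (z * n.+1%:R) = k.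
    by apply: floor_def.
  exact: set_mem gB.
apply: countable_bigcupT_measurable => [|k]; first exact: countableP.
apply: measurableI.
  have := (measurableT_comp (mg (k%:~R / n.+1%:R)) (@measurable_fst _ _ Y R)).
  move=> /(_ measurableT B mB); rewrite setTI; congr (measurable _).
  by apply/seteqP; split => p /=; [move/mem_set|move/set_mem].
have m2 : measurable_fun [set: Y * R] (fun p : Y * R => p.2 * n.+1%:R : R).
  by apply: measurable_funM => //.
have -> : [set p : Y * R | (k%:~R <= p.2 * n.+1%:R) && (p.2 * n.+1%:R < (k + 1)%:~R)]
  = (fun p : Y * R => p.2 * n.+1%:R : R) @^-1` `[k%:~R, (k+1)%:~R[.
  by apply/seteqP; split => p /=; rewrite in_itv.
rewrite -[X in measurable X]setTI; exact: m2.
Qed.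

Lemma continuous_measurable3 (f : (R * R) * R -> R) :
  continuous f -> measurable_fun [set: (R * R) * R] f.
Proof.
move=> cf; apply: measurable_fun_caratheodory => [z|[x y]].
  apply: (measurable_fun_caratheodory (g := fun xy => f (xy, z))) => [y|x].
    apply: continuous_measurable_fun => x.
    apply: (@continuous_comp _ _ _ (fun x => ((x, y), z)) f); last exact: cf.
    by do ?[apply: continuous_pairat | exact: continuous_idat | exact: continuous_cstat].
  move=> y; apply: (@continuous_comp _ _ _ (fun y => ((x, y), z)) f); last exact: cf.
  by do ?[apply: continuous_pairat | exact: continuous_idat | exact: continuous_cstat].
move=> z; apply: (@continuous_comp _ _ _ (fun z => ((x, y), z)) f); last exact: cf.
by do ?[apply: continuous_pairat | exact: continuous_idat | exact: continuous_cstat].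
Qed.

(** The continuous functions [x / (x^2 + 1/(n+1))] converge to the inverse at every point, including
    0, where they vanish and the inverse is 0 by convention. *)
Lemma measurable_invr : measurable_fun [set: R] (@GRing.inv R).
Proof.
pose h (n : nat) (x : R) : R := x * (x ^+ 2 + n.+1%:R^-1)^-1.
apply: (measurable_fun_cvg (h := h)) => [n|x _].
  apply: continuous_measurable_fun => x; rewrite /h.
  apply: cvgM; first exact: cvg_id.
  apply: cvgV; last by apply: cvgD; [exact: exprn_continuous|exact: cvg_cst].
  by rewrite gt_eqF// ltr_wpDl ?sqr_ge0// invr_gt0.
rewrite /h; have [->|x0] := eqVneq x 0.
  by rewrite invr0; under eq_cvg do rewrite mul0r; exact: cvg_cst.
rewrite -[X in _ --> X](_ : x * (x ^+ 2 + 0)^-1 = _); last first.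
  by rewrite addr0 expr2 invfM mulrA mulfV// mul1r.
apply: cvgM; first exact: cvg_cst.
apply: cvgV; first by rewrite addr0 expf_neq0.
apply: cvgD; first exact: cvg_cst.
exact: cvg_harmonic.
Qed.

Lemma measurable_sqrt : measurable_fun [set: R] (@Num.sqrt R).
Proof. by apply: continuous_measurable_fun; exact: sqrt_continuous. Qed.

End Measurability.

Section TonelliSet.
Context (R : realType) d1 d2 (Y1 : measurableType d1) (Y2 : measurableType d2).
Variables (m1 : {sigma_finite_measure set Y1 -> \bar R})
  (m2 : {sigma_finite_measure set Y2 -> \bar R}).
Variables (D : set Y1) (E : set Y2) (mD : measurable D) (mE : measurable E).
Variable G : Y1 * Y2 -> \bar R.
Hypothesis mG : measurable_fun [set: Y1 * Y2] G.

Section NonnegOnRectangle.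
Hypothesis G0 : forall p, (D `*` E) p -> (0 <= G p)%E.

Let GDE := G \_ (D `*` E).

Let mGDE : measurable_fun [set: Y1 * Y2] GDE.
Proof.
apply/(measurable_restrictT _ _).1; first exact: measurableX.
exact: measurable_funTS.
Qed.

Let GDE0 p : (0 <= GDE p)%E.
Proof. by apply: erestrict_ge0. Qed.

Let GDEE y z : GDE (y, z) = if (y \in D) && (z \in E) then G (y, z) else 0%E.
Proof. by rewrite /GDE patchE in_setX. Qed.

Lemma tonelli_setX1 :
  (\int[m1 \x m2]_(p in D `*` E) G p =
   \int[m1]_(y in D) \int[m2]_(z in E) G (y, z))%E.
Proof.
rewrite [LHS]integral_mkcond [RHS]integral_mkcond -/GDE (fubini_tonelli1 _ mGDE GDE0).
apply: eq_integral => y _; rewrite /fubini_F patchE.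
case: ifPn => yD.
  rewrite [RHS]integral_mkcond; apply: eq_integral => z _.
  by rewrite -/GDE GDEE yD patchE.
by apply: integral0_eq => z _; rewrite -/GDE GDEE (negbTE yD).
Qed.

Lemma tonelli_setX2 :
  (\int[m1 \x m2]_(p in D `*` E) G p =
   \int[m2]_(z in E) \int[m1]_(y in D) G (y, z))%E.
Proof.
rewrite [LHS]integral_mkcond [RHS]integral_mkcond -/GDE (fubini_tonelli2 _ mGDE GDE0).
apply: eq_integral => z _; rewrite /fubini_G patchE.
case: ifPn => zE.
  rewrite [RHS]integral_mkcond; apply: eq_integral => y _.
  by rewrite -/GDE GDEE zE andbT patchE.
by apply: integral0_eq => y _; rewrite -/GDE GDEE (negbTE zE) andbF.
Qed.

(** Nonnegativity is asked on the rectangle only: the intended integrand is a derivative shifted by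
    a bound that holds on a cube and may fail outside it. *)
Lemma le_tonelli_setX1 (b : R) : 0 <= b ->
  (forall y, D y -> b%:E <= \int[m2]_(z in E) G (y, z))%E ->
  (b%:E * m1 D <= \int[m1 \x m2]_(p in D `*` E) G p)%E.
Proof.
move=> b0 Hb; rewrite integral_mkcond fubini_tonelli1// -(integral_cst m1 mD).
have mF := measurable_fun_fubini_tonelli_F (m2 := m2) GDE mGDE GDE0.
have F0 y : (0 <= fubini_F m2 GDE y)%E by apply: integral_ge0.
apply: (@le_trans _ _ (\int[m1]_(y in D) fubini_F m2 GDE y)%E); last first.
  by apply: ge0_subset_integral.
apply: ge0_le_integral => //.
  exact: measurable_funTS.
move=> y Dy; apply: le_trans (Hb y Dy) _.
rewrite /fubini_F [X in (X <= _)%E]integral_mkcond le_eqVlt; apply/orP; left; apply/eqP.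
by apply: eq_integral => z _; rewrite GDEE mem_set//= patchE.
Qed.

Lemma le_tonelli_setX2 (b : R) : 0 <= b ->
  (forall z, E z -> b%:E <= \int[m1]_(y in D) G (y, z))%E ->
  (b%:E * m2 E <= \int[m1 \x m2]_(p in D `*` E) G p)%E.
Proof.
move=> b0 Hb; rewrite integral_mkcond fubini_tonelli2// -(integral_cst m2 mE).
have mF := measurable_fun_fubini_tonelli_G (m1 := m1) GDE mGDE GDE0.
have F0 y : (0 <= fubini_G m1 GDE y)%E by apply: integral_ge0.
apply: (@le_trans _ _ (\int[m2]_(y in E) fubini_G m1 GDE y)%E); last first.
  by apply: ge0_subset_integral.
apply: ge0_le_integral => //.
  exact: measurable_funTS.
move=> z Ez; apply: le_trans (Hb z Ez) _.
rewrite /fubini_G [X in (X <= _)%E]integral_mkcond le_eqVlt; apply/orP; left; apply/eqP.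
by apply: eq_integral => y _; rewrite GDEE (mem_set Ez) andbT patchE.
Qed.

End NonnegOnRectangle.

Hypothesis G0 : forall p, (0 <= G p)%E.

Lemma measurable_integral1 : measurable_fun [set: Y1] (fun y => \int[m2]_(z in E) G (y, z))%E.
Proof.
rewrite [X in measurable_fun _ X](_ : _ = fubini_F m2 (G \_ (setT `*` E))).
  apply: measurable_fun_fubini_tonelli_F => [|p]; last exact: erestrict_ge0.
  apply/(measurable_restrictT _ _).1; first exact: measurableX.
  exact: measurable_funTS.
apply/funext => y; rewrite integral_mkcond; apply: eq_integral => z _.
by rewrite !patchE in_setX in_setT.
Qed.

Lemma measurable_integral2 : measurable_fun [set: Y2] (fun z => \int[m1]_(y in D) G (y, z))%E.
Proof.
rewrite [X in measurable_fun _ X](_ : _ = fubini_G m1 (G \_ (D `*` setT))).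
  apply: measurable_fun_fubini_tonelli_G => [|p]; last exact: erestrict_ge0.
  apply/(measurable_restrictT _ _).1; first exact: measurableX.
  exact: measurable_funTS.
apply/funext => z; rewrite integral_mkcond; apply: eq_integral => y _.
by rewrite !patchE in_setX in_setT andbT.
Qed.

End TonelliSet.

(** * One-dimensional inequalities *)


Section RealIntegrands.
Context d (Y : measurableType d) (R : realType) (m : {measure set Y -> \bar R}).
Variables (D : set Y) (mD : measurable D).
Implicit Types f g : Y -> R.
Local Open Scope ereal_scope.

Lemma integral_le_EFin f g : measurable_fun D f -> measurable_fun D g ->
  (forall y, D y -> (0 <= f y)%R) -> (forall y, D y -> (f y <= g y)%R) ->
  \int[m]_(y in D) (f y)%:E <= \int[m]_(y in D) (g y)%:E.
Proof.
move=> mf mg f0 fg; apply: ge0_le_integral => //.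
- exact/measurable_EFinP.
- exact/measurable_EFinP.
Qed.

Lemma integralD_EFin f g : measurable_fun D f -> measurable_fun D g ->
  (forall y, D y -> (0 <= f y)%R) -> (forall y, D y -> (0 <= g y)%R) ->
  \int[m]_(y in D) (f y + g y)%:E = \int[m]_(y in D) (f y)%:E + \int[m]_(y in D) (g y)%:E.
Proof.
move=> mf mg f0 g0; under eq_integral do rewrite EFinD.
rewrite ge0_integralD//.
- exact/measurable_EFinP.
- exact/measurable_EFinP.
Qed.

Lemma integralZ_EFin f (k : R) : measurable_fun D f ->
  (forall y, D y -> (0 <= f y)%R) -> (0 <= k)%R ->
  \int[m]_(y in D) (k * f y)%:E = k%:E * \int[m]_(y in D) (f y)%:E.
Proof.
move=> mf f0 k0; under eq_integral do rewrite EFinM.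
rewrite ge0_integralZl_EFin//.
exact/measurable_EFinP.
Qed.

Lemma integral_ge0_EFin f : (forall y, D y -> (0 <= f y)%R) ->
  0 <= \int[m]_(y in D) (f y)%:E.
Proof. by move=> f0; apply: integral_ge0 => y Dy; rewrite lee_fin f0. Qed.

End RealIntegrands.

Section OneDim.
Variable R : realType.
Local Notation leb := (@lebesgue_measure R).
Implicit Types (f F : R -> R) (L : R).

Lemma lebesgue_measure_seg (a b : R) : a <= b -> leb `[a, b]%classic = (b - a)%:E.
Proof.
move=> ab; rewrite lebesgue_measure_itv /= lte_fin; case: ltP => // ba.
by have -> : a = b; [lra|rewrite subrr].
Qed.

Lemma integral_derive_seg F f (a b : R) : a <= b ->
  (forall t : R, is_derive t 1 F (f t)) -> continuous f ->
  (\int[leb]_(t in `[a, b]) (f t)%:E = (F b - F a)%:E)%E.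
Proof.
rewrite le_eqVlt => /predU1P[->|ab] dF cf.
  by rewrite set_itv1 integral_set1 subrr.
have cF : continuous F.
  move=> t; apply: differentiable_continuous; apply/derivable1_diffP.
  by have [] := dF t.
rewrite (continuous_FTC2 ab _ (F := F)) ?EFinB//.
- exact: continuous_subspaceT.
- split.
  + by move=> t _; have [] := dF t.
  + by apply: cvg_at_right_filter; exact: cF.
  + by apply: cvg_at_left_filter; exact: cF.
- by move=> t _; rewrite derive1E; have [_ ->] := dF t.
Qed.

(** The shift by [B] lets a derivative of unknown sign be made nonnegative, as Tonelli requires; of
    the primitive, only the comparison of the two endpoints remains. *)
Lemma integral_derive_ge F f (L B : R) : 0 <= L ->
  (forall t : R, is_derive t 1 F (f t)) -> continuous f -> F (- L) <= F L ->
  (((2 * L * B)%R)%:E <= \int[leb]_(t in `[(- L)%R, L]) (f t + B)%:E)%E.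
Proof.
move=> L0 dF cf FL.
have dG (t : R) : is_derive t 1 (fun t => F t + B * t) (f t + B).
  apply: is_deriveD.
  rewrite [X in is_derive _ _ _ X](_ : B = B * 1); last by rewrite mulr1.
  exact: is_deriveZ.
rewrite (integral_derive_seg _ dG); [by rewrite lee_fin; lra|lra|].
by move=> t; apply: cvgD; [exact: cf|exact: cvg_cst].
Qed.

(* Cauchy-Schwarz via 2 s f <= f^2 + s^2, optimised over s. *)
Lemma sqr_increment_le F f (L x y : R) : 0 < L ->
  (forall t : R, is_derive t 1 F (f t)) -> continuous f ->
  - L <= x <= L -> - L <= y <= L ->
  (((F x - F y) ^+ 2)%:E <=
     (2 * L)%:E * \int[leb]_(t in `[(- L)%R, L]) (f t ^+ 2)%:E)%E.
Proof.
move=> L0 dF cf; wlog xy : x y / y <= x.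
  move=> H hx hy; have [yx|/ltW xy] := leP y x; first exact: H.
  rewrite (_ : (F x - F y) ^+ 2 = (F y - F x) ^+ 2); last by ring.
  exact: H.
move=> hx hy.
have mf : measurable_fun [set: R] f by exact: continuous_measurable_fun.
have mI : measurable `[- L, L]%classic by exact: measurable_itv.
set I := (X in (_ * X)%E).
have I0 : (0 <= I)%E by apply: integral_ge0_EFin => t _; exact: sqr_ge0.
have key s : ((2 * s * (F x - F y))%:E <= I + (s ^+ 2 * (2 * L))%:E)%E.
  have -> : 2 * s * (F x - F y) = 2 * s * F x - 2 * s * F y by ring.
  have csf : continuous (fun t => 2 * s * f t).
    by move=> t; apply: cvgM; [exact: cvg_cst|exact: cf].
  have cqf : continuous (fun t => f t ^+ 2 + s ^+ 2).
    move=> t; apply: cvgD; last exact: cvg_cst.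
    by apply: (@continuous_comp _ _ _ f (fun u => u ^+ 2)); [exact: cf|exact: exprn_continuous].
  have dG (t : R) : is_derive t 1 (fun t => 2 * s * F t) (2 * s * f t).
    exact: is_deriveZ.
  rewrite -(integral_derive_seg xy dG)//.
  have -> : (s ^+ 2 * (2 * L))%:E = (\int[leb]_(t in `[(- L)%R, L]) (s ^+ 2)%:E)%E.
    rewrite (integral_cst leb mI (s ^+ 2)%:E) /= lebesgue_measure_seg; last lra.
    by rewrite EFinM; congr (_ * _%:E)%E; lra.
  have mq : measurable_fun `[- L, L]%classic (fun t => f t ^+ 2).
    by apply: measurable_funTS; exact: measurable_funX.
  rewrite /I -(@integralD_EFin _ _ _ leb _ mI (fun t => f t ^+ 2) (fun=> s ^+ 2))//; last 2 first.
  - by move=> t _; exact: sqr_ge0.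
  - by move=> t _; exact: sqr_ge0.
  apply: (@le_trans _ _ (\int[leb]_(t in `[y, x]) (f t ^+ 2 + s ^+ 2)%:E)%E).
    apply: le_integral => //.
    - apply: continuous_compact_integrable; first exact: segment_compact.
      exact: continuous_subspaceT.
    - apply: continuous_compact_integrable; first exact: segment_compact.
      exact: continuous_subspaceT.
    - by move=> t _; rewrite lee_fin; have := sqr_ge0 (f t - s); nra.
  apply: ge0_subset_integral => //.
  - apply/measurable_EFinP/measurable_funTS; exact: continuous_measurable_fun.
  - by move=> t _; rewrite lee_fin addr_ge0 ?sqr_ge0.
  - by move=> t /=; rewrite !in_itv/= => /andP[h1 h2]; apply/andP; split; lra.
(* The energy may be infinite, in which case the bound is trivial. Otherwise the optimal [s] is the
   increment divided by [2 L]. *)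
move: I0 key; case: I => [I| |]//= I0 key.
  rewrite -EFinM lee_fin.
  have := key ((F x - F y) / (2 * L)); rewrite -EFinD lee_fin.
  set a := F x - F y; rewrite -(@ler_pM2l _ (2 * L)); last lra.
  have -> : 2 * L * (2 * (a / (2 * L)) * a) = 2 * a ^+ 2 by field; lra.
  have -> : 2 * L * (I + (a / (2 * L)) ^+ 2 * (2 * L)) = 2 * L * I + a ^+ 2.
    by field; lra.
  lra.
by rewrite gt0_muley ?leey// lte_fin; lra.
Qed.

(** If [h] exceeded its mean everywhere on the segment, the difference would be positive with zero
    integral, hence zero almost everywhere on a set of positive length. This selects a slice of
    controlled energy. *)
Lemma exists_le_mean (h : R -> \bar R) (L : R) : 0 < L ->
  measurable_fun [set: R] h -> (forall t, (0 <= h t)%E) ->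
  exists2 t, - L <= t <= L & ((2 * L)%:E * h t <= \int[leb]_(s in `[(- L)%R, L]) h s)%E.
Proof.
move=> L0 mh h0; apply: contrapT => Hn.
have {}Hn t : - L <= t <= L -> (\int[leb]_(s in `[(- L)%R, L]) h s < (2 * L)%:E * h t)%E.
  by move=> ht; rewrite ltNge; apply/negP => hle; apply: Hn; exists t.
have mI : measurable `[- L, L]%classic by exact: measurable_itv.
have mhI : measurable_fun `[- L, L]%classic h by exact: measurable_funTS.
move: Hn; have : (0 <= \int[leb]_(s in `[(- L)%R, L]) h s)%E by exact: integral_ge0.
case E : (\int[leb]_(s in `[(- L)%R, L]) h s)%E => [J| |] // J0 Hn; last first.
  have /Hn : - L <= 0 <= L by apply/andP; split; lra.
  by rewrite ltNge leey.
have ih : leb.-integrable `[- L, L] h.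
  apply/integrableP; split => //.
  by under eq_integral do rewrite gee0_abs//; rewrite E ltry.
pose k := J / (2 * L).
have ik : leb.-integrable `[- L, L] (cst k%:E).
  apply/integrableP; split; first exact: measurable_cst.
  rewrite (integral_cst leb mI `|k%:E|%E) /= lebesgue_measure_seg; last lra.
  by rewrite -EFinM ltry.
have hk t : - L <= t <= L -> (k%:E < h t)%E.
  move=> /Hn; have := h0 t; case: (h t) => [r| |]//=; last by rewrite ltry.
  by rewrite -EFinM !lte_fin /k ltr_pdivrMr 1?[r * _]mulrC//; lra.
have : (\int[leb]_(s in `[(- L)%R, L]) `|h s - cst k%:E s| = 0)%E.
  transitivity (\int[leb]_(s in `[(- L)%R, L]) (h s - cst k%:E s))%E.
    apply: eq_integral => s; rewrite inE/= in_itv/= => hs.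
    rewrite gee0_abs// -/(h s - k%:E)%E; have := hk s hs.
    case: (h s) => [r| |]; last by rewrite ltNge leNye.
      by rewrite lte_fin -EFinB lee_fin => ?; lra.
    by rewrite addye// leey.
  rewrite integralB// E (integral_cst leb mI) /= lebesgue_measure_seg; last lra.
  rewrite -EFinM -EFinB /k; congr (_%:E); field; lra.
have mhk : measurable_fun `[- L, L]%classic (fun s => h s - cst k%:E s)%E.
  by apply: emeasurable_funB => //; exact: measurable_cst.
move=> /(ae_eq_integral_abs leb mI mhk) -[N [mN N0 sN]].
have : (leb `[(- L)%R, L]%classic <= leb N)%E.
  apply: le_measure; rewrite ?inE//.
  move=> t/= ht; apply: sN => /=.
  move=> /(_ ht) /eqP; apply/negP.
  have := hk t; rewrite in_itv/= in ht => /(_ ht).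
  by case: (h t) => [r| |]//=; rewrite lte_fin => kr; rewrite -EFinB eqe subr_eq0 gt_eqF.
by rewrite N0 lebesgue_measure_seg ?lee_fin; lra.
Qed.

End OneDim.

Section Step.
Context d (Y : measurableType d) (R : realType).
Variables (m : {sigma_finite_measure set Y -> \bar R}) (D : set Y) (L : R).
Local Notation leb := (@lebesgue_measure R).
Local Notation I := (`[- L, L]%classic : set R).

(* The constant [c] is that of the slice at a height [z'] where the slice energy is at
   most its mean. *)
Lemma poincare_step (f E E' : Y * R -> R) (K K' : R) :
  0 < L -> measurable D -> measurable_fun [set: Y * R] f ->
  measurable_fun [set: Y * R] E -> measurable_fun [set: Y * R] E' ->
  (forall p, 0 <= E p) -> (forall p, 0 <= E' p) -> 0 <= K -> 0 <= K' ->
  (forall z, - L <= z <= L -> exists c, 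
    (\int[m]_(y in D) ((f (y, z) - c) ^+ 2)%:E <= K%:E * \int[m]_(y in D) (E (y, z))%:E)%E) ->
  (forall y z', - L <= z' <= L ->
    (\int[leb]_(z in I) ((f (y, z) - f (y, z')) ^+ 2)%:E <=
     K'%:E * \int[leb]_(z in I) (E' (y, z))%:E)%E) ->
  exists c, (\int[m \x leb]_(p in D `*` I) ((f p - c) ^+ 2)%:E <=
    (2 * (K + K'))%:E * \int[m \x leb]_(p in D `*` I) (E p + E' p)%:E)%E.
Proof.
move=> L0 mD mf mE mE' E0 E'0 K0 K'0 HK HK'.
have mI : measurable I by exact: measurable_itv.
have mDI : measurable (D `*` I) by exact: measurableX.
have mEE : measurable_fun [set: Y * R] (EFin \o E) by exact/measurable_EFinP.
have mA := measurable_integral2 m mD mEE (fun p => E0 p).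
have A0 z : (0 <= \int[m]_(y in D) (EFin \o E) (y, z))%E.
  by apply: integral_ge0_EFin => y _; exact: E0.
have [z' hz' zle] := exists_le_mean L0 mA A0.
have [c hc] := HK z' hz'; exists c.
have mf1 : measurable_fun [set: Y * R] (fun p => f (p.1, z')).
  apply: (measurableT_comp (f := fun y => f (y, z'))) => //.
  exact: measurable_fun_pair1.
have mg : measurable_fun [set: Y * R] (fun p => (f p - f (p.1, z')) ^+ 2).
  by apply: measurable_funX; exact: measurable_funB.
have mh : measurable_fun [set: Y * R] (fun p => (f (p.1, z') - c) ^+ 2).
  by apply: measurable_funX; exact: measurable_funB.
have m2 (g : Y * R -> R) : measurable_fun [set: Y * R] g ->
    measurable_fun [set: Y * R] (fun p => 2 * g p).
  by move=> mg'; apply: measurable_funM.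
(* The path from [f p] to [c] goes through the value on the slice [z'], with
   [(a + b)^2 <= 2 a^2 + 2 b^2]; hence the factor 2 in the constant. *)
apply: (@le_trans _ _ (\int[m \x leb]_(p in D `*` I)
   (2 * (f p - f (p.1, z')) ^+ 2 + 2 * (f (p.1, z') - c) ^+ 2)%:E)%E).
  apply: integral_le_EFin => //.
  - by apply: measurable_funTS; apply: measurable_funX; exact: measurable_funB.
  - by apply: measurable_funTS; apply: measurable_funD; exact: m2.
  - by move=> p _; exact: sqr_ge0.
  - move=> p _; have := sqr_ge0 ((f p - f (p.1, z')) - (f (p.1, z') - c)).
    by rewrite -subr_ge0 => ?; rewrite -subr_ge0; lra.
rewrite integralD_EFin//; last 4 first.
- by apply: measurable_funTS; exact: m2.
- by apply: measurable_funTS; exact: m2.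
- by move=> p _; rewrite mulr_ge0 ?sqr_ge0.
- by move=> p _; rewrite mulr_ge0 ?sqr_ge0.
rewrite !integralZ_EFin//; try by [move=> p _; exact: sqr_ge0 | exact: measurable_funTS].
have H1 : (\int[m \x leb]_(p in D `*` I) ((f p - f (p.1, z')) ^+ 2)%:E <=
   K'%:E * \int[m \x leb]_(p in D `*` I) (E' p)%:E)%E.
  have mE'E : measurable_fun [set: Y * R] (EFin \o E') by exact/measurable_EFinP.
  have mgE : measurable_fun [set: Y * R] (fun p => ((f p - f (p.1, z')) ^+ 2)%:E).
    exact/measurable_EFinP.
  rewrite -integralZ_EFin//; last 1 first.
  - exact: measurable_funTS.
  rewrite (tonelli_setX1 m leb mD mI mgE) => [|p _]; last by rewrite lee_fin sqr_ge0.
  rewrite (tonelli_setX1 m leb mD mI (G := fun p => (K' * E' p)%:E)); last 2 first.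
  - by apply/measurable_EFinP; apply: measurable_funM.
  - by move=> p _; rewrite lee_fin mulr_ge0.
  apply: ge0_le_integral => //.
  - by move=> y _; apply: integral_ge0_EFin => z _; exact: sqr_ge0.
  - apply: measurable_funTS; apply: (measurable_integral1 leb mI mgE).
    by move=> p; rewrite lee_fin sqr_ge0.
  - apply: measurable_funTS; apply: (measurable_integral1 leb mI (G := fun p => (K' * E' p)%:E)).
    + by apply/measurable_EFinP; apply: measurable_funM.
    + by move=> p; rewrite lee_fin mulr_ge0.
  - move=> y _; apply: le_trans (HK' y z' hz') _; rewrite integralZ_EFin//.
    by apply: measurable_funTS; exact: measurable_fun_pair2.
have H2 : (\int[m \x leb]_(p in D `*` I) ((f (p.1, z') - c) ^+ 2)%:E <=
   K%:E * \int[m \x leb]_(p in D `*` I) (E p)%:E)%E.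
  have mhE : measurable_fun [set: Y * R] (fun p => ((f (p.1, z') - c) ^+ 2)%:E).
    exact/measurable_EFinP.
  rewrite (tonelli_setX2 m leb mD mI mhE) => [|p _]; last by rewrite lee_fin sqr_ge0.
  rewrite (tonelli_setX2 m leb mD mI mEE) => [|p _]; last by rewrite lee_fin.
  rewrite /= (integral_cst leb mI) /= lebesgue_measure_seg; last lra.
  apply: le_trans (lee_wpmul2l _ zle); last by rewrite lee_fin.
  rewrite muleCA muleC (_ : L - - L = 2 * L); last by ring.
  by apply: lee_wpmul2l hc; rewrite lee_fin; lra.
rewrite integralD_EFin//; try exact: measurable_funTS.
rewrite [X in (_ <= X)%E]ge0_muleDr; try exact: integral_ge0_EFin.
have KK : (0 <= (2 * (K + K'))%:E :> \bar R)%E by rewrite lee_fin; lra.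
rewrite [X in (X <= _)%E]addeC; apply: leeD.
  apply: le_trans (lee_wpmul2l _ H2) _; first by rewrite lee_fin.
  rewrite muleA -EFinM; apply: lee_wpmul2r; first exact: integral_ge0_EFin.
  by rewrite lee_fin; lra.
apply: le_trans (lee_wpmul2l _ H1) _; first by rewrite lee_fin.
rewrite muleA -EFinM; apply: lee_wpmul2r; first exact: integral_ge0_EFin.
by rewrite lee_fin; lra.
Qed.

End Step.

(** * Cubes *)


(* The library's sigma-finiteness instance on [m1 \x m2] is shadowed by the one for
   subprobabilities, hence a named copy of the planar Lebesgue measure. *)
Section PlanarLebesgue.
Variable R : realType.

Definition leb2 := (@lebesgue_measure R \x @lebesgue_measure R)%E.

HB.instance Definition _ := Measure.on leb2.

Lemma leb2_sigma_finite : sigma_finite setT leb2.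
Proof.
have /sigma_finiteP[F [TF ndF Foo]] := sigma_finiteT (@lebesgue_measure R).
exists (fun n => F n `*` F n).
  rewrite -setXTT TF predeqE => -[x y]; split.
    move=> [/= [n _ Fnx] [k _ Fky]]; exists (maxn n k) => //; split.
    - by move: x Fnx; exact/subsetPset/ndF/leq_maxl.
    - by move: y Fky; exact/subsetPset/ndF/leq_maxr.
  by move=> [n _ []/= ? ?]; split; exists n.
move=> k; have [? ?] := Foo k.
split; first exact: measurableX.
by rewrite /leb2 product_measure1E// lte_mul_pinfty// ge0_fin_numE.
Qed.

HB.instance Definition _ := Measure_isSigmaFinite.Build _ _ _ leb2 leb2_sigma_finite.

End PlanarLebesgue.

Section Cube.
Variable R : realType.
Local Notation leb := (@lebesgue_measure R).
Local Notation leb3 := (@leb3 R).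
Local Notation pt3 := (pt3 R).
Implicit Types (f : pt3 -> R) (L : R).

Definition seg L : set R := `[- L, L]%classic.
Definition cube L : set pt3 := (seg L `*` seg L) `*` seg L.

Lemma segP L t : seg L t <-> - L <= t <= L.
Proof. by rewrite /seg /= in_itv. Qed.

Lemma cubeP L (p : pt3) :
  cube L p <-> [/\ - L <= cx p <= L, - L <= cy p <= L & - L <= cz p <= L].
Proof.
case: p => [[x y] z]; rewrite /cube /cx /cy /cz /=; split.
  by move=> [[/segP h1 /segP h2] /segP h3].
by move=> [/segP h1 /segP h2 /segP h3].
Qed.

Lemma measurable_seg L : measurable (seg L).
Proof. exact: measurable_itv. Qed.

Lemma measurable_cube L : measurable (cube L).
Proof. by do 2?apply: measurableX; exact: measurable_seg. Qed.

Lemma compact_cube L : compact (cube L).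
Proof. by do 2?apply: compact_setX; exact: segment_compact. Qed.

Lemma bounded_on_cube f L : continuous f ->
  exists2 B : R, 0 <= B & forall p, cube L p -> `|f p| <= B.
Proof.
move=> cf.
have : bounded_set [set f x | x in cube L].
  apply: compact_bounded; apply: continuous_compact; last exact: compact_cube.
  exact: continuous_subspaceT.
move=> [M [_ HM]]; exists (`|M| + 1); first by rewrite addr_ge0.
move=> p Qp; apply: (HM (`|M| + 1)); last by exists p.
by rewrite (le_lt_trans (ler_norm _))// ltrDl.
Qed.

(** Derivatives along coordinate lines are all that the fundamental theorem on lines uses;
    continuity of the partial derivatives is asked separately. *)
Definition C1lines f (f0 f1 f2 : pt3 -> R) :=
  [/\ forall y z x : R, is_derive x 1 (fun t => f (t, y, z)) (f0 (x, y, z)),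
      forall x z y : R, is_derive y 1 (fun t => f (x, t, z)) (f1 (x, y, z)) &
      forall x y z : R, is_derive z 1 (fun t => f (x, y, t)) (f2 (x, y, z))].

Lemma continuous_line0 f y z : continuous f -> continuous (fun t => f (t, y, z)).
Proof.
move=> cf t; apply: (@continuous_comp _ _ _ (fun t => ((t, y), z)) f); last exact: cf.
by do ?[apply: continuous_pairat | exact: continuous_idat | exact: continuous_cstat].
Qed.

Lemma continuous_line1 f x z : continuous f -> continuous (fun t => f (x, t, z)).
Proof.
move=> cf t; apply: (@continuous_comp _ _ _ (fun t => ((x, t), z)) f); last exact: cf.
by do ?[apply: continuous_pairat | exact: continuous_idat | exact: continuous_cstat].
Qed.

Lemma continuous_line2 f x y : continuous f -> continuous (fun t => f (x, y, t)).
Proof.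
move=> cf t; apply: (@continuous_comp _ _ _ (fun t => ((x, y), t)) f); last exact: cf.
by do ?[apply: continuous_pairat | exact: continuous_idat | exact: continuous_cstat].
Qed.

(** The reference value is [F y] for an arbitrary point [y] rather than the mean, because the
    induction on dimension compares with a chosen slice. One factor [2 L] comes from the increment
    bound, the other from integrating it. *)
Lemma poincare_seg (F f : R -> R) L y : 0 < L ->
  (forall t : R, is_derive t 1 F (f t)) -> continuous f -> - L <= y <= L ->
  (\int[leb]_(x in seg L) ((F x - F y) ^+ 2)%:E <=
   ((2 * L) ^+ 2)%:E * \int[leb]_(x in seg L) (f x ^+ 2)%:E)%E.
Proof.
move=> L0 dF cf hy.
have mF : measurable_fun [set: R] F.
  apply: continuous_measurable_fun => t.
  apply: differentiable_continuous; apply/derivable1_diffP; by have [] := dF t.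
set J := (X in (_ <= _ * X)%E).
have J0 : (0 <= J)%E by apply: integral_ge0_EFin => t _; exact: sqr_ge0.
apply: (@le_trans _ _ (\int[leb]_(x in seg L) cst ((2 * L)%:E * J) x)%E).
  apply: ge0_le_integral.
  - exact: measurable_seg.
  - by move=> x _; rewrite lee_fin sqr_ge0.
  - apply/measurable_EFinP/measurable_funTS; apply: measurable_funX.
    by apply: measurable_funB.
  - exact: measurable_cst.
  - by move=> x /segP hx; exact: sqr_increment_le.
rewrite (integral_cst leb (measurable_seg L)) /= lebesgue_measure_seg; last lra.
by rewrite muleAC -EFinM (_ : _ * (L - - L) = (2 * L) ^+ 2)//; ring.
Qed.

(** Two applications of [poincare_step], starting from the constant [(2 L)^2] of a segment: the
    square gets [2 (1 + 1) = 4] times it, the cube [2 (4 + 1) = 10] times it. *)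
Lemma poincare_cube f (f0 f1 f2 : pt3 -> R) L : 0 < L -> C1lines f f0 f1 f2 ->
  continuous f -> continuous f0 -> continuous f1 -> continuous f2 ->
  exists c, (\int[leb3]_(p in cube L) ((f p - c) ^+ 2)%:E <=
    (10 * (2 * L) ^+ 2)%:E *
      \int[leb3]_(p in cube L) (f0 p ^+ 2 + f1 p ^+ 2 + f2 p ^+ 2)%:E)%E.
Proof.
move=> L0 [df0 df1 df2] cf cf0 cf1 cf2.
have m3 (g : pt3 -> R) : continuous g -> measurable_fun [set: pt3] g
  by exact: continuous_measurable3.
have K0 : 0 <= (2 * L) ^+ 2 by exact: sqr_ge0.
have q0 (g : pt3 -> R) (p : pt3) : 0 <= g p ^+ 2 by exact: sqr_ge0.
have mq (g : pt3 -> R) : continuous g -> measurable_fun [set: pt3] (fun p => g p ^+ 2).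
  by move=> cg; apply: measurable_funX; exact: m3.
have -> : 10 * (2 * L) ^+ 2 = 2 * (4 * (2 * L) ^+ 2 + (2 * L) ^+ 2) by ring.
apply: (poincare_step (m := @leb2 R) (f := f) (E := fun p => f0 p ^+ 2 + f1 p ^+ 2)
  (E' := fun p => f2 p ^+ 2) L0).
- by apply: measurableX; exact: measurable_seg.
- exact: m3.
- by apply: measurable_funD; exact: mq.
- exact: mq.
- by move=> p; rewrite addr_ge0.
- exact: q0.
- by rewrite mulr_ge0.
- exact: K0.
- move=> z hz.
  have mz (g : pt3 -> R) : continuous g -> measurable_fun [set: R * R] (fun xy => g (xy, z)).
    by move=> cg; apply: measurable_fun_pair1; exact: m3.
  have -> : 4 * (2 * L) ^+ 2 = 2 * ((2 * L) ^+ 2 + (2 * L) ^+ 2) by ring.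
  apply: (@poincare_step _ _ R (@lebesgue_measure R) (seg L) L (fun xy => f (xy, z))
    (fun xy => f0 (xy, z) ^+ 2) (fun xy => f1 (xy, z) ^+ 2) _ _ L0 (measurable_seg L)).
  + exact: mz.
  + by apply: measurable_funX; exact: mz.
  + by apply: measurable_funX; exact: mz.
  + by move=> p; exact: sqr_ge0.
  + by move=> p; exact: sqr_ge0.
  + exact: K0.
  + exact: K0.
  + move=> y hy; exists (f (0, y, z)).
    apply: (poincare_seg L0 (df0 y z)); first exact: continuous_line0.
    by apply/andP; split; lra.
  + move=> x y' hy'; apply: (poincare_seg L0 (df1 x z)) => //.
    exact: continuous_line1.
- move=> [x y] z' hz'; apply: (poincare_seg L0 (df2 x y)) => //.
  exact: continuous_line2.
Qed.

(** There is one alternative for each direction, because each term of a divergence is controlled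
    along its own coordinate lines, which must be integrated first. *)
Lemma le_integral_cube (G : pt3 -> R) L (b : R) : 0 <= L -> 0 <= b ->
  measurable_fun [set: pt3] G -> (forall p, cube L p -> 0 <= G p) ->
  [\/ forall y z, seg L y -> seg L z -> 
        ((2 * L * b)%R%:E <= \int[leb]_(x in seg L) (G (x, y, z))%:E)%E,
      forall x z, seg L x -> seg L z -> 
        ((2 * L * b)%R%:E <= \int[leb]_(y in seg L) (G (x, y, z))%:E)%E |
      forall x y, seg L x -> seg L y -> 
        ((2 * L * b)%R%:E <= \int[leb]_(z in seg L) (G (x, y, z))%:E)%E] ->
  (((2 * L) ^+ 3 * b)%:E <= \int[leb3]_(p in cube L) (G p)%:E)%E.
Proof.
move=> L0 b0 mG G0.
have mI := measurable_seg L.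
have mGE : measurable_fun [set: pt3] (EFin \o G) by exact/measurable_EFinP.
have mGz z : measurable_fun [set: R * R] (fun xy => (G (xy, z))%:E).
  exact: measurable_fun_pair1 mGE.
have b1 : 0 <= 2 * L * b by rewrite !mulr_ge0.
have b2 : 0 <= (2 * L) ^+ 2 * b by rewrite mulr_ge0// sqr_ge0.
have V1 : leb (seg L) = (2 * L)%:E by rewrite lebesgue_measure_seg; [congr EFin; ring|lra].
have E3 : ((2 * L) ^+ 3 * b)%:E = (((2 * L) ^+ 2 * b)%:E * leb (seg L))%E.
  by rewrite V1 -EFinM; congr EFin; ring.
have E2 : ((2 * L) ^+ 2 * b)%:E = ((2 * L * b)%:E * leb (seg L))%E.
  by rewrite V1 -EFinM; congr EFin; ring.
have mII : measurable (seg L `*` seg L) by exact: measurableX.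
case=> H.
- rewrite E3; refine (@le_tonelli_setX2 R _ _ _ _ (@leb2 R) leb _ _ mII mI _ mGE _ _ _ _) => //.
  move=> z Iz; rewrite /= E2.
  refine (@le_tonelli_setX2 R _ _ _ _ leb leb _ _ mI mI _ (mGz z) _ _ _ _) => //.
    by move=> xy Ixy; rewrite /= lee_fin; exact: G0.
  by move=> y Iy; exact: H.
- rewrite E3; refine (@le_tonelli_setX2 R _ _ _ _ (@leb2 R) leb _ _ mII mI _ mGE _ _ _ _) => //.
  move=> z Iz; rewrite /= E2.
  refine (@le_tonelli_setX1 R _ _ _ _ leb leb _ _ mI mI _ (mGz z) _ _ _ _) => //.
    by move=> xy Ixy; rewrite /= lee_fin; exact: G0.
  by move=> y Iy; exact: H.
- have -> : ((2 * L) ^+ 3 * b)%:E =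
      ((2 * L * b)%:E * @leb2 R (seg L `*` seg L))%E.
    by rewrite /leb2 product_measure1E//= V1 -!EFinM; congr EFin; ring.
  refine (@le_tonelli_setX1 R _ _ _ _ (@leb2 R) leb _ _ mII mI _ mGE _ _ _ _) => //.
  by move=> [x y] [Ix Iy]; exact: H.
Qed.

Lemma leb3_cube L : 0 <= L -> leb3 (cube L) = ((2 * L) ^+ 3)%:E.
Proof.
move=> L0; have mI := measurable_seg L.
have V1 : leb (seg L) = (2 * L)%:E by rewrite lebesgue_measure_seg; [congr EFin; ring|lra].
rewrite /leb3 /cube product_measure1E//; last exact: measurableX.
transitivity ((leb \x leb)%E (seg L `*` seg L) * leb (seg L))%E => //.
by rewrite product_measure1E//= V1 -!EFinM; congr EFin; ring.
Qed.

(* The divergence theorem on a cube, reduced to a one-sided bound: the boundary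
   terms of an outward pointing field have a sign and are dropped. *)
Lemma divergence_cube_le (F0 F1 F2 h0 h1 h2 u v : pt3 -> R) L : 0 <= L ->
  continuous h0 -> continuous h1 -> continuous h2 ->
  measurable_fun [set: pt3] u -> measurable_fun [set: pt3] v ->
  (forall y z x : R, is_derive x 1 (fun t => F0 (t, y, z)) (h0 (x, y, z))) ->
  (forall x z y : R, is_derive y 1 (fun t => F1 (x, t, z)) (h1 (x, y, z))) ->
  (forall x y z : R, is_derive z 1 (fun t => F2 (x, y, t)) (h2 (x, y, z))) ->
  (forall y z, F0 (- L, y, z) <= F0 (L, y, z)) ->
  (forall x z, F1 (x, - L, z) <= F1 (x, L, z)) ->
  (forall x y, F2 (x, y, - L) <= F2 (x, y, L)) ->
  (forall p, 0 <= u p) -> (forall p, 0 <= v p) ->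
  (forall p, h0 p + h1 p + h2 p + u p <= v p) ->
  (\int[leb3]_(p in cube L) (u p)%:E <= \int[leb3]_(p in cube L) (v p)%:E)%E.
Proof.
move=> L0 ch0 ch1 ch2 mu mv d0 d1 d2 s0 s1 s2 u0 v0 uv.
have [B0 B00 HB0] := bounded_on_cube L ch0.
have [B1 B10 HB1] := bounded_on_cube L ch1.
have [B2 B20 HB2] := bounded_on_cube L ch2.
(* Adding [B] to each of the three terms makes them nonnegative on the cube. The total shift, [3 B]
   times the volume, is finite and appears on both sides of [key], so it cancels at the end. *)
pose B := B0 + B1 + B2.
have Bge0 : 0 <= B by rewrite /B; lra.
have bnd (h : pt3 -> R) k p : `|h p| <= k -> k <= B -> 0 <= h p + B.
  by move=> + kB; rewrite ler_norml => /andP[? ?]; lra.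
have p0 p : cube L p -> 0 <= h0 p + B.
  by move=> /HB0 H; apply: bnd H _; rewrite /B; lra.
have p1 p : cube L p -> 0 <= h1 p + B.
  by move=> /HB1 H; apply: bnd H _; rewrite /B; lra.
have p2 p : cube L p -> 0 <= h2 p + B.
  by move=> /HB2 H; apply: bnd H _; rewrite /B; lra.
have m3 (g : pt3 -> R) : continuous g -> measurable_fun [set: pt3] g
  by exact: continuous_measurable3.
have mh (h : pt3 -> R) : continuous h -> measurable_fun [set: pt3] (fun p => h p + B).
  by move=> ch; apply: measurable_funD => //; exact: m3.
have I0 : (((2 * L) ^+ 3 * B)%:E <= \int[leb3]_(p in cube L) (h0 p + B)%:E)%E.
  apply: le_integral_cube => //; first exact: mh.
  apply: Or31 => y z _ _.
  refine (@integral_derive_ge R _ (fun t => h0 (t, y, z)) L B L0 (d0 y z) _ _) => //.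
  exact: continuous_line0.
have I1 : (((2 * L) ^+ 3 * B)%:E <= \int[leb3]_(p in cube L) (h1 p + B)%:E)%E.
  apply: le_integral_cube => //; first exact: mh.
  apply: Or32 => x z _ _.
  refine (@integral_derive_ge R _ (fun t => h1 (x, t, z)) L B L0 (d1 x z) _ _) => //.
  exact: continuous_line1.
have I2 : (((2 * L) ^+ 3 * B)%:E <= \int[leb3]_(p in cube L) (h2 p + B)%:E)%E.
  apply: le_integral_cube => //; first exact: mh.
  apply: Or33 => x y _ _.
  refine (@integral_derive_ge R _ (fun t => h2 (x, y, t)) L B L0 (d2 x y) _ _) => //.
  exact: continuous_line2.
have mQ := measurable_cube L.
have mQh (h : pt3 -> R) : continuous h -> measurable_fun (cube L) (fun p => h p + B).
  by move=> ch; apply: measurable_funTS; exact: mh.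
have mQu : measurable_fun (cube L) u by exact: measurable_funTS.
have mQv : measurable_fun (cube L) v by exact: measurable_funTS.
have key : (\int[leb3]_(p in cube L) (h0 p + B)%:E +
   \int[leb3]_(p in cube L) (h1 p + B)%:E + \int[leb3]_(p in cube L) (h2 p + B)%:E +
   \int[leb3]_(p in cube L) (u p)%:E <=
   \int[leb3]_(p in cube L) (v p)%:E + (3 * ((2 * L) ^+ 3 * B))%:E)%E.
  have m01 : measurable_fun (cube L) (fun p => h0 p + B + (h1 p + B)).
    by apply: measurable_funD; exact: mQh.
  have m012 : measurable_fun (cube L) (fun p => h0 p + B + (h1 p + B) + (h2 p + B)).
    by apply: measurable_funD => //; exact: mQh.
  have p01 p : cube L p -> 0 <= h0 p + B + (h1 p + B).
    by move=> Qp; rewrite addr_ge0 ?p0 ?p1.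
  have p012 p : cube L p -> 0 <= h0 p + B + (h1 p + B) + (h2 p + B).
    by move=> Qp; rewrite addr_ge0 ?p2 ?p01.
  have E01 : (\int[leb3]_(p in cube L) (h0 p + B)%:E + \int[leb3]_(p in cube L) (h1 p + B)%:E
      = \int[leb3]_(p in cube L) (h0 p + B + (h1 p + B))%:E)%E.
    by rewrite -integralD_EFin//; exact: mQh.
  have E012 : (\int[leb3]_(p in cube L) (h0 p + B + (h1 p + B))%:E +
      \int[leb3]_(p in cube L) (h2 p + B)%:E
      = \int[leb3]_(p in cube L) (h0 p + B + (h1 p + B) + (h2 p + B))%:E)%E.
    by rewrite -integralD_EFin//; exact: mQh.
  rewrite E01 E012 -integralD_EFin//.
  have -> : (3 * ((2 * L) ^+ 3 * B))%:E = (\int[leb3]_(p in cube L) (3 * B)%:E)%E.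
    rewrite (integral_cst leb3 mQ).
    transitivity ((3 * B)%:E * ((2 * L) ^+ 3)%:E)%E.
      by rewrite -EFinM; congr EFin; ring.
    by congr (_ * _)%E; rewrite -(leb3_cube L0).
  rewrite -integralD_EFin//; last by move=> p _; lra.
  apply: integral_le_EFin => //.
  - exact: measurable_funD.
  - exact: measurable_funD.
  - by move=> p Qp; rewrite addr_ge0 ?p012.
  - by move=> p _; have := uv p; lra.
have fin : (3 * ((2 * L) ^+ 3 * B))%:E \is a fin_num by [].
rewrite -(leeD2rE _ _ fin); apply: le_trans key.
rewrite addeC; apply: leeD => //.
rewrite (_ : 3 * ((2 * L) ^+ 3 * B) =
  (2 * L) ^+ 3 * B + (2 * L) ^+ 3 * B + (2 * L) ^+ 3 * B); last by ring.
by rewrite !EFinD; do 2?apply: leeD.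
Qed.

End Cube.

(** * The complex square root *)


Section ComplexPhase.
Variable R : realType.
Implicit Types (z v : cplx R).

Lemma cabs_ge0 z : 0 <= cabs z.
Proof. exact: sqrtr_ge0. Qed.

Lemma cabs_sqr z : cabs z ^+ 2 = z.1 ^+ 2 + z.2 ^+ 2.
Proof. by rewrite /cabs sqr_sqrtr// addr_ge0 ?sqr_ge0. Qed.

Lemma csqrt_re_ge0 z : 0 <= (csqrt z).1.
Proof. exact: sqrtr_ge0. Qed.

Lemma normr_re_le_cabs z : `|z.1| <= cabs z.
Proof.
rewrite -(ler_pXn2r (n := 2)) ?nnegrE ?cabs_ge0// cabs_sqr real_normK ?num_real//.
by rewrite lerDl sqr_ge0.
Qed.

Lemma csqrt_re_sqr z : (csqrt z).1 ^+ 2 = (cabs z + z.1) / 2.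
Proof.
have := normr_re_le_cabs z; rewrite ler_norml => /andP[h1 h2].
by rewrite /csqrt /= sqr_sqrtr//; lra.
Qed.

Lemma csqrt_im_sqr z : (csqrt z).2 ^+ 2 = (cabs z - z.1) / 2.
Proof.
have := normr_re_le_cabs z; rewrite ler_norml => /andP[h1 h2].
rewrite /csqrt /= exprMn sqr_sqrtr; last lra.
by case: ifP => _; ring.
Qed.

(* The bounds express [|nu| |1+s|^2 ~ 1 + |nu|] and [nu (1-s) = 4/(1+s)] with [Re s >= 0]. *)
Lemma cabs_phase_bounds v : 0 < cabs v ->
  let s := csqrt (csub (creal 1) (cmul (creal 4) (cinv v))) in
  [/\ 4 + cabs v <= 2 * (cabs v * cabs (Defs.cadd (creal 1) s) ^+ 2),
      cabs v * cabs (Defs.cadd (creal 1) s) ^+ 2 <= 4 * cabs v + 8 &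
      `|cRe (cmul v (csub (creal 1) s))| <= 4].
Proof.
move=> N0; set z := csub _ _ => s.
set N := cabs v in N0 *.
have N2 : N ^+ 2 = v.1 ^+ 2 + v.2 ^+ 2 by exact: cabs_sqr.
set r := cabs z.
have r0 : 0 <= r by exact: cabs_ge0.
have s10 : 0 <= s.1 by exact: csqrt_re_ge0.
have s12 : s.1 ^+ 2 = (r + z.1) / 2 by exact: csqrt_re_sqr.
have s22 : s.2 ^+ 2 = (r - z.1) / 2 by exact: csqrt_im_sqr.
have Nn0 : N != 0 by rewrite gt_eqF.
have z1 : z.1 * N ^+ 2 = N ^+ 2 - 4 * v.1.
  rewrite /z /csub /creal /cmul /cinv /= -N2; field; exact: Nn0.
have z2 : z.2 * N ^+ 2 = 4 * v.2.
  rewrite /z /csub /creal /cmul /cinv /= -N2; field; exact: Nn0.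
have r2 : r ^+ 2 = z.1 ^+ 2 + z.2 ^+ 2 by exact: cabs_sqr.
(* Since [z = 1 - 4/v], the number [N * r] is [|v - 4|], which lies between [4 - N] and [N + 4]. *)
have Nr : (N * r) ^+ 2 = N ^+ 2 - 8 * v.1 + 16.
  apply: (mulIf (x := N ^+ 2)); first by rewrite expf_neq0.
  have -> : (N * r) ^+ 2 * N ^+ 2 = (z.1 * N ^+ 2) ^+ 2 + (z.2 * N ^+ 2) ^+ 2.
    by rewrite exprMn r2; ring.
  by rewrite z1 z2; have := N2; set n2 := N ^+ 2 => ->; ring.
have vN : `|v.1| <= N by exact: normr_re_le_cabs.
move: vN; rewrite ler_norml => /andP[vN1 vN2].
have Nr0 : 0 <= N * r by rewrite mulr_ge0// ltW.
have Nr_ge : 4 - N <= N * r.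
  have [h|h] := leP (4 - N) 0; first exact: le_trans h Nr0.
  rewrite -(ler_pXn2r (n := 2)) ?nnegrE//; last exact: ltW.
  rewrite Nr; have -> : (4 - N) ^+ 2 = N ^+ 2 - 8 * N + 16 by ring.
  lra.
have Nr_le : N * r <= N + 4.
  rewrite -(ler_pXn2r (n := 2)) ?nnegrE//; last lra.
  rewrite Nr; have -> : (N + 4) ^+ 2 = N ^+ 2 + 8 * N + 16 by ring.
  lra.
(* Here [|s|^2 = |z| = r], as [s] is a square root of [z]. *)
have E : cabs (Defs.cadd (creal 1) s) ^+ 2 = 1 + 2 * s.1 + r.
  rewrite cabs_sqr; transitivity ((1 + s.1) ^+ 2 + (0 + s.2) ^+ 2) => //.
  have -> : (1 + s.1) ^+ 2 + (0 + s.2) ^+ 2 = 1 + 2 * s.1 + (s.1 ^+ 2 + s.2 ^+ 2) by ring.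
  by rewrite s12 s22; field.
have Ns : 0 <= N * s.1 by rewrite mulr_ge0// ltW.
rewrite E; split.
- by rewrite (_ : N * (1 + 2 * s.1 + r) = N + 2 * (N * s.1) + N * r); [lra|ring].
- have s1r : 2 * s.1 <= 1 + r.
    have : s.1 ^+ 2 <= r.
      rewrite s12; have := normr_re_le_cabs z; rewrite ler_norml => /andP[_]; rewrite -/r; lra.
    by have := sqr_ge0 (s.1 - 1); rewrite sqrrB1 => ? ?; lra.
  have : N * (2 * s.1) <= N * (1 + r) by rewrite ler_pM2l.
  rewrite (_ : N * (1 + r) = N + N * r); last by ring.
  rewrite (_ : N * (1 + 2 * s.1 + r) = N + N * (2 * s.1) + N * r); last by ring.
  lra.
(* [A] is [|1 - s|^2]. From [(1 - s)(1 + s) = 4/v] one gets [N^2 A |1 + s|^2 = 16], and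
   [|1 + s| >= 1] because [Re s >= 0]; Cauchy-Schwarz then bounds the real part of the product. *)
- pose A := (1 - s.1) ^+ 2 + s.2 ^+ 2.
  have A0 : 0 <= A by rewrite addr_ge0 ?sqr_ge0.
  have AB : N ^+ 2 * A * (1 + 2 * s.1 + r) = 16.
    have -> : A = 1 - 2 * s.1 + (s.1 ^+ 2 + s.2 ^+ 2) by rewrite /A; ring.
    have -> : s.1 ^+ 2 + s.2 ^+ 2 = r by rewrite s12 s22; field.
    have -> : N ^+ 2 * (1 - 2 * s.1 + r) * (1 + 2 * s.1 + r) =
      N ^+ 2 + 2 * N ^+ 2 * r + (N * r) ^+ 2 - 4 * N ^+ 2 * s.1 ^+ 2 by ring.
    rewrite s12 Nr.
    have -> : 4 * N ^+ 2 * ((r + z.1) / 2) = 2 * N ^+ 2 * r + 2 * (z.1 * N ^+ 2) by field.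
    rewrite z1; ring.
  have DA : N ^+ 2 * A <= 16.
    rewrite -AB ler_peMr ?mulr_ge0 ?sqr_ge0//; lra.
  rewrite -(ler_pXn2r (n := 2)) ?nnegrE// real_normK ?num_real//.
  have -> : cRe (cmul v (csub (creal 1) s)) = v.1 * (1 - s.1) - v.2 * (0 - s.2) by [].
  have : (v.1 * (1 - s.1) - v.2 * (0 - s.2)) ^+ 2 <= N ^+ 2 * A.
    rewrite N2 /A -subr_ge0.
    have -> : (v.1 ^+ 2 + v.2 ^+ 2) * ((1 - s.1) ^+ 2 + s.2 ^+ 2) -
       (v.1 * (1 - s.1) - v.2 * (0 - s.2)) ^+ 2 = (v.1 * s.2 - v.2 * (1 - s.1)) ^+ 2 by ring.
    exact: sqr_ge0.
  lra.
Qed.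

Lemma ln_le_subr1 (x : R) : 0 < x -> ln x <= x - 1.
Proof.
move=> x0; have := @le_ln1Dx R (x - 1); rewrite (_ : 1 + (x - 1) = x); last by ring.
by apply; lra.
Qed.

(** The bounds of [cabs_phase_bounds] put [|v| |1 + s|^2] between [(1 + |v|)/2] and [8 (1 + |v|)].
    The constant is 9 = 7 + 2, with [ln 8 <= 7] and half of the bound 4 on the real part. The
    estimate holds at every [v], so no null set has to be removed later. *)
Lemma phase_near_ln v :
  let s := csqrt (csub (creal 1) (cmul (creal 4) (cinv v))) in
  `|ln (cabs v) + 2 * ln (cabs (Defs.cadd (creal 1) s)) +
    2^-1 * cRe (cmul v (csub (creal 1) s)) - ln (1 + cabs v)| <= 9.
Proof.
(* At [v = 0] the conventions [1/0 = 0] and [ln 0 = 0] give [s = 1], and the expression is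
   [2 ln 2]. *)
have := cabs_ge0 v; rewrite le_eqVlt => /predU1P[v0|v0].
  have v2 : v.1 ^+ 2 + v.2 ^+ 2 = 0 by rewrite -cabs_sqr -v0 expr0n.
  have v10 : v.1 = 0.
    by apply/eqP; rewrite -sqrf_eq0; apply/eqP; have := sqr_ge0 v.1; have := sqr_ge0 v.2; lra.
  have v20 : v.2 = 0.
    by apply/eqP; rewrite -sqrf_eq0; apply/eqP; have := sqr_ge0 v.1; have := sqr_ge0 v.2; lra.
  cbv zeta; have -> : csub (creal 1) (cmul (creal 4) (cinv v)) = (1, 0).
    rewrite /csub /creal /cmul /cinv /= v10 v20.
    by congr pair; rewrite !(mul0r, mulr0, oppr0, subr0, addr0).
  have -> : csqrt (1, 0) = (1, 0) :> cplx R.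
    rewrite /csqrt /cabs /= expr0n /= addr0 expr1n sqrtr1 subrr mul0r sqrtr0 mulr0.
    by rewrite (_ : (1 + 1) / 2 = 1 :> R) ?sqrtr1//; field.
  have -> : cabs (Defs.cadd (creal 1) (1, 0)) = 2 :> R.
    rewrite /cabs /Defs.cadd /creal /= addr0 expr0n /= addr0 sqrtr_sqr ger0_norm//; lra.
  rewrite -v0 ln0// addr0 ln1 /cRe /cmul /= v10 v20 !(mul0r, mulr0, subr0).
  have h2 := @ln_le_subr1 2 ltac:(lra).
  have h1 : 0 <= ln (2 : R) by apply: ln_ge0; lra.
  by rewrite ger0_norm; lra.
cbv zeta; have [H1 H2 H3] := cabs_phase_bounds v0.
set s := csqrt _ in H1 H2 H3 *.
have W0 : 0 < cabs (Defs.cadd (creal 1) s).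
  rewrite lt_neqAle cabs_ge0 andbT; apply/eqP => W.
  by move: H1; rewrite -/s -W expr0n/= mulr0; lra.
have -> : ln (cabs v) + 2 * ln (cabs (Defs.cadd (creal 1) s)) =
   ln (cabs v * cabs (Defs.cadd (creal 1) s) ^+ 2).
  rewrite lnM ?posrE ?exprn_gt0// lnXn// mulr_natl; ring.
move: H1 H2 H3; rewrite -/s; set N := cabs v in v0 *; set W := N * _ => H1 H2.
set X := cRe _; rewrite ler_norml => /andP[X1 X2].
have W00 : 0 < W by lra.
have U : ln W <= ln 8 + ln (1 + N).
  by rewrite -lnM ?posrE//; [rewrite ler_ln ?posrE//; lra|lra].
have L : ln (1 + N) <= ln 2 + ln W.
  by rewrite -lnM ?posrE//; rewrite ler_ln ?posrE//; lra.
have h2 := @ln_le_subr1 2 ltac:(lra).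
have h8 := @ln_le_subr1 8 ltac:(lra).
by rewrite ler_norml; apply/andP; split; lra.
Qed.

End ComplexPhase.

(** * The smooth potential *)


Section Surrogate.
Variables (R : realType) (mu lam e : R).
Hypotheses (mu0 : 0 < mu) (lam0 : 0 < lam) (e01 : 0 < e < 1).
Local Notation pt3 := (pt3 R).
Implicit Types p : pt3.

Definition jbracket p : R := Num.sqrt (1 + cx p ^+ 2 + cy p ^+ 2 + cz p ^+ 2).
Definition ecc : R := Num.sqrt (1 - e ^+ 2) / e.
(* A smooth substitute for [1 + |nu|^2 lam^4/mu^2]. *)
Definition smooth_nu p : R := 1 + (jbracket p - cx p / e) ^+ 2 + (cy p * ecc) ^+ 2.
Definition potential p : R := lam * ln (smooth_nu p) - 2 * mu / lam * jbracket p.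

Let e0 : 0 < e. Proof. by case/andP: e01. Qed.

Lemma jbracket_sqr p : jbracket p ^+ 2 = 1 + cx p ^+ 2 + cy p ^+ 2 + cz p ^+ 2.
Proof. by rewrite sqr_sqrtr// !addr_ge0 ?sqr_ge0. Qed.

Lemma jbracket_ge1 p : 1 <= jbracket p.
Proof.
rewrite -(ler_pXn2r (n := 2)) ?nnegrE ?sqrtr_ge0// jbracket_sqr expr1n.
by have := sqr_ge0 (cx p); have := sqr_ge0 (cy p); have := sqr_ge0 (cz p); lra.
Qed.

Lemma smooth_nu_ge1 p : 1 <= smooth_nu p.
Proof. by rewrite /smooth_nu -addrA lerDl addr_ge0 ?sqr_ge0. Qed.

Lemma norm3_sqr p : norm3 p ^+ 2 = cx p ^+ 2 + cy p ^+ 2 + cz p ^+ 2.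
Proof. by rewrite sqr_sqrtr// !addr_ge0 ?sqr_ge0. Qed.

Lemma norm3_jbracket p : norm3 p <= jbracket p <= norm3 p + 1.
Proof.
have n0 : 0 <= norm3 p by exact: sqrtr_ge0.
have j1 := jbracket_ge1 p.
have E : jbracket p ^+ 2 = norm3 p ^+ 2 + 1 by rewrite jbracket_sqr norm3_sqr; ring.
apply/andP; split.
  by rewrite -(ler_pXn2r (n := 2)) ?nnegrE//; lra.
rewrite -(ler_pXn2r (n := 2)) ?nnegrE//; try lra.
Qed.

(** With [m = mu/lam^2], [|nu| = m P], where [P^2] is [smooth_nu - 1] with [|x|] in place of the
    bracket. That replacement moves the argument of a square by some [d] in [[0, 1]], so [smooth_nu]
    and [(1 + P)^2] agree up to the factors 3 and 6. *)
Lemma ln_cabs_nu_smooth : exists2 c, 0 <= c & forall p,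
  `|ln (1 + cabs (nu mu lam e p)) - 2^-1 * ln (smooth_nu p)| <= c.
Proof.
pose m := mu / lam ^+ 2; have m0 : 0 < m by rewrite divr_gt0 ?exprn_gt0.
(* This [k] compares [1 + m P] with [1 + P] in both directions, whether [m] is large or small. *)
pose k := 1 + m + m^-1; have k1 : 1 <= k.
  by rewrite /k -addrA lerDl addr_ge0 ?invr_ge0 ?(ltW m0).
have lnk : 0 <= ln k by exact: ln_ge0.
have ln6 : 0 <= ln (6 : R) by apply: ln_ge0; lra.
have ln36 : ln (3 : R) <= ln 6 by rewrite ler_ln ?posrE; lra.
exists (ln k + ln 6) => [|p]; first by rewrite addr_ge0.
pose P := Num.sqrt ((norm3 p - cx p / e) ^+ 2 + (cy p * ecc) ^+ 2).
have P0 : 0 <= P by exact: sqrtr_ge0.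
have P2 : P ^+ 2 = (norm3 p - cx p / e) ^+ 2 + (cy p * ecc) ^+ 2.
  by rewrite sqr_sqrtr// addr_ge0 ?sqr_ge0.
have -> : cabs (nu mu lam e p) = m * P.
  apply/eqP; rewrite -(eqrXn2 (n := 2)) ?cabs_ge0 ?(mulr_ge0 (ltW m0) P0)//.
  have -> : (m * P) ^+ 2 = m ^+ 2 * P ^+ 2 by ring.
  rewrite cabs_sqr P2 /nu /= /ecc -/m; apply/eqP; ring.
have [j1 j2] := andP (norm3_jbracket p).
set t := norm3 p - cx p / e in P2.
have qE : smooth_nu p = 1 + (t + (jbracket p - norm3 p)) ^+ 2 + (cy p * ecc) ^+ 2.
  by rewrite /smooth_nu /t; congr (_ + _ ^+ 2 + _); ring.
have q1 := smooth_nu_ge1 p.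
set d := jbracket p - norm3 p in qE; have d0 : 0 <= d <= 1 by apply/andP; split; rewrite /d; lra.
have y2 := sqr_ge0 (cy p * ecc); set y := (cy p * ecc) ^+ 2 in y2 P2 qE.
have d2 : d ^+ 2 <= 1 by case/andP: d0 => ? ?; rewrite expr_le1.
have EP : (1 + P) ^+ 2 = 1 + 2 * P + P ^+ 2 by ring.
have ub : smooth_nu p <= 3 * (1 + P) ^+ 2.
  rewrite qE EP P2; have := sqr_ge0 (t - d).
  have -> : (t - d) ^+ 2 = 2 * t ^+ 2 + 2 * d ^+ 2 - (t + d) ^+ 2 by ring.
  by have := sqr_ge0 t; lra.
have lb : (1 + P) ^+ 2 <= 6 * smooth_nu p.
  have := sqr_ge0 (P - 1); have -> : (P - 1) ^+ 2 = 1 - 2 * P + P ^+ 2 by ring.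
  rewrite qE EP P2; have := sqr_ge0 (t + 2 * d).
  have -> : (t + 2 * d) ^+ 2 = 2 * (t + d) ^+ 2 + 2 * d ^+ 2 - t ^+ 2 by ring.
  by have := sqr_ge0 (t + d); lra.
have P1 : 0 < 1 + P by lra.
have mP0 : 0 <= m * P by rewrite mulr_ge0// ltW.
have h1 : ln (1 + m * P) <= ln k + ln (1 + P).
  rewrite -lnM ?posrE//; last lra.
  rewrite ler_ln ?posrE//; [|lra|by rewrite mulr_gt0//; lra].
  have : 0 <= m^-1 * (1 + P) by rewrite mulr_ge0 ?invr_ge0 ?(ltW m0) ?(ltW P1).
  by rewrite /k; lra.
have h2 : ln (1 + P) <= ln k + ln (1 + m * P).
  rewrite -lnM ?posrE//; try lra.
  rewrite ler_ln ?posrE//; last by rewrite mulr_gt0//; lra.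
  have : 0 <= m * (1 + m * P) by rewrite mulr_ge0 ?(ltW m0)//; lra.
  have -> : k * (1 + m * P) = 1 + m * P + m * (1 + m * P) + (m^-1 + P).
    by rewrite /k; field; lra.
  by have : 0 <= m^-1 by [rewrite invr_ge0 (ltW m0)]; lra.
have lnP2 : ln ((1 + P) ^+ 2) = 2 * ln (1 + P) by rewrite lnXn// mulr_natl.
have h3 : ln (smooth_nu p) <= ln 3 + 2 * ln (1 + P).
  by rewrite -lnP2 -lnM ?posrE ?exprn_gt0// ler_ln ?posrE ?mulr_gt0 ?exprn_gt0//; lra.
have h4 : 2 * ln (1 + P) <= ln 6 + ln (smooth_nu p).
  rewrite -lnP2 -lnM ?posrE//; try lra.
  by rewrite ler_ln ?posrE ?mulr_gt0 ?exprn_gt0//; lra.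
by rewrite ler_norml; apply/andP; split; lra.
Qed.

(** Both terms carry the same factor [1/eps^2], so a bound uniform in [p] of the brackets suffices.
    The constant adds up three errors: 9 from the phase, [c0] from replacing [|nu|], and [2 mu/lam]
    from [S - |x| <= 1]. *)
Lemma Reps_near_potential : exists2 c, 0 <= c & forall eps p, 0 < eps ->
  `|2 * Reps mu lam e eps p - potential p / eps ^+ 2| <= c / eps ^+ 2.
Proof.
have [c0 c00 H] := ln_cabs_nu_smooth.
have ml0 : 0 < 2 * mu / lam by rewrite divr_gt0 ?mulr_gt0.
exists (2 * lam * (9 + c0) + 2 * mu / lam).
  by rewrite addr_ge0 ?(ltW ml0)// !mulr_ge0 ?(ltW lam0)//; lra.
move=> eps p eps0; have := H p; have := phase_near_ln (nu mu lam e p); cbv zeta.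
have [j1 j2] := andP (norm3_jbracket p).
rewrite /Reps /potential -/(sq mu lam e p).
set A := ln (cabs _); set B := ln _; set C := cRe _; set D := ln (1 + _).
set E := ln _; set j := jbracket p in j1 j2 *; set r := norm3 p in j1 j2 *.
move=> h1 h2; have i0 : 0 < (eps ^+ 2)^-1 by rewrite invr_gt0 exprn_gt0.
have -> : 2 * (lam / eps ^+ 2 * (A + 2 * B - mu * r / lam ^+ 2 + 2^-1 * C)) -
    (lam * E - 2 * mu / lam * j) / eps ^+ 2 =
    (2 * lam * ((A + 2 * B + 2^-1 * C - D) + (D - 2^-1 * E)) +
     2 * mu / lam * (j - r)) / eps ^+ 2.
  by field; rewrite (gt_eqF lam0) (gt_eqF eps0).
rewrite normrM (ger0_norm (ltW i0)) ler_pM2r//.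
apply: le_trans (ler_normD _ _) _; apply: lerD.
  rewrite normrM ger0_norm; last by rewrite mulr_ge0// ltW.
  rewrite ler_pM2l ?mulr_gt0//; apply: le_trans (ler_normD _ _) _; exact: lerD.
rewrite normrM (ger0_norm (ltW ml0)) ler_piMr// ?(ltW ml0)// ger0_norm; lra.
Qed.

End Surrogate.

(** * The Lyapunov field *)


Section WeightedFieldLine.
Variable R : realType.

Lemma is_derive_sqrt_sqr (h : R -> R) (t : R) : is_derive t 1 h (2 * t) -> 0 < h t ->
  is_derive t 1 (fun x => Num.sqrt (h x)) (t / Num.sqrt (h t)).
Proof.
move=> dh ht; have s0 : Num.sqrt (h t) != 0 by rewrite gt_eqF// sqrtr_gt0.
have := is_derive1_comp (is_derive1_sqrt ht) dh.
by rewrite (_ : _^-1 * (2 * t) = t / Num.sqrt (h t))//; field.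
Qed.

Lemma is_derive_sqr (h : R -> R) (dh t : R) : is_derive t 1 h dh ->
  is_derive t 1 (fun x => h x ^+ 2) (2 * h t * dh).
Proof.
move=> H; have := @is_deriveX _ _ h 2 t 1 dh H.
by rewrite /GRing.scale /= expr1.
Qed.

(** A single computation for the three partial derivatives: [U] and [V] stand for [x/e] and [y ecc]
    along a coordinate line, where at most one of them varies. *)
Lemma is_derive_weighted_field (n lam a : R) (S U V g : R -> R) (u v dg t : R) :
  0 < S t -> is_derive t 1 S (t / S t) -> is_derive t 1 U u -> is_derive t 1 V v ->
  is_derive t 1 g dg ->
  let q := 1 + (S t - U t) ^+ 2 + V t ^+ 2 in
  let w := expR (n * (lam * ln q - a * S t)) in
  is_derive t 1 (fun x => g x ^+ 2 *
      (expR (n * (lam * ln (1 + (S x - U x) ^+ 2 + V x ^+ 2) - a * S x)) * (x / S x)))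
    (2 * g t * dg * (w * (t / S t)) + g t ^+ 2 * (w *
      (n * (lam * ((2 * (S t - U t) * (t / S t - u) + 2 * V t * v) / q) - a * (t / S t)) * (t / S t)
       + ((S t)^-1 - t ^+ 2 / S t ^+ 3)))).
Proof.
move=> S0 dS dU dV dg' q w.
have q0 : 0 < q by rewrite /q -addrA ltr_pwDl// addr_ge0 ?sqr_ge0.
have dq : is_derive t 1 (fun x => 1 + (S x - U x) ^+ 2 + V x ^+ 2)
    (2 * (S t - U t) * (t / S t - u) + 2 * V t * v).
  apply: is_deriveD; last exact: is_derive_sqr.
  rewrite -[X in is_derive _ _ _ X]add0r; apply: is_deriveD.
  by apply: is_derive_sqr; apply: is_deriveB.
set dq' := _ + _ in dq.
have dl : is_derive t 1 (fun x => ln (1 + (S x - U x) ^+ 2 + V x ^+ 2)) (q^-1 * dq').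
  exact: (@is_derive1_comp R (@ln R) (fun x => 1 + (S x - U x) ^+ 2 + V x ^+ 2) t _ _
    (is_derive1_ln q0) dq).
have dG : is_derive t 1 (fun x => n * (lam * ln (1 + (S x - U x) ^+ 2 + V x ^+ 2) - a * S x))
    (n * (lam * (q^-1 * dq') - a * (t / S t))).
  by apply: is_deriveZ; apply: is_deriveB; apply: is_deriveZ.
have dw : is_derive t 1
   (fun x => expR (n * (lam * ln (1 + (S x - U x) ^+ 2 + V x ^+ 2) - a * S x)))
   (w * (n * (lam * (q^-1 * dq') - a * (t / S t)))).
  exact: (@is_derive1_comp R (@expR R) (fun x => n * (lam *
    ln (1 + (S x - U x) ^+ 2 + V x ^+ 2) - a * S x)) t _ _ (is_derive_expR _) dG).
have dSV : is_derive t 1 (fun x => (S x)^-1) (- (S t) ^- 2 * (t / S t)).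
  by apply: is_deriveV; rewrite gt_eqF.
have dX : is_derive t 1 (fun x => x / S x) (t * (- (S t) ^- 2 * (t / S t)) + (S t)^-1 * 1).
  exact: is_deriveM.
have dP := is_deriveM (is_derive_sqr dg') (is_deriveM dw dX).
apply: is_derive_eq dP _.
rewrite /GRing.scale /= -/q -/w -[X in _ + X * _ = _]/(w * (t / S t)) /dq'.
move: q0 S0; clear dq dl dG dw dSV dX dS dU dV dg' dq'.
move: q w (S t) (U t) (V t) (g t) => Q W s x y z Q0 s0.
by field; rewrite (gt_eqF s0) (gt_eqF Q0).
Qed.

End WeightedFieldLine.

Section WeightedField.
Variables (R : realType) (mu lam e : R).
Local Notation pt3 := (pt3 R).
Local Notation S := (@jbracket R).
Local Notation q := (smooth_nu e).
Local Notation ecc := (ecc e).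

Definition weight (n : R) (p : pt3) : R := expR (n * potential mu lam e p).

(* [2 (S - x/e) (p_i/S - u) + 2 (k y) v] is the [i]-th partial derivative of [smooth_nu]
   for [(u, v) = (1/e, 0), (0, k), (0, 0)]. *)
Definition field_deriv (n u v c : R) (X f df : pt3 -> R) (p : pt3) : R :=
  2 * (f p - c) * df p * (weight n p * (X p / S p)) + (f p - c) ^+ 2 * (weight n p *
  (n * (lam * ((2 * (S p - cx p / e) * (X p / S p - u) + 2 * (cy p * ecc) * v) / q p)
        - 2 * mu / lam * (X p / S p)) * (X p / S p) + ((S p)^-1 - X p ^+ 2 / S p ^+ 3))).

Definition field_comp (n c : R) (X f : pt3 -> R) (p : pt3) : R :=
  (f p - c) ^+ 2 * (weight n p * (X p / S p)).

Lemma jbracket_gt0 p : 0 < S p.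
Proof. exact: lt_le_trans ltr01 (jbracket_ge1 p). Qed.

Lemma is_derive_cst_id (b t : R) : is_derive t 1 (fun x : R => b) 0.
Proof. exact: is_derive_cst. Qed.

Lemma is_derive_subc (g : R -> R) (dg c t : R) : is_derive t 1 g dg ->
  is_derive t 1 (fun x => g x - c) dg.
Proof.
by move=> H; rewrite -[dg]subr0; apply: is_deriveB.
Qed.

Lemma is_derive_addl (b t : R) (g : R -> R) (dg : R) : is_derive t 1 g dg ->
  is_derive t 1 (fun x => b + g x) dg.
Proof.
move=> H; apply: is_derive_eq (is_deriveD (is_derive_cst b t (1 : R)) H) _.
by rewrite add0r.
Qed.

Lemma is_derive_addr (b t : R) (g : R -> R) (dg : R) : is_derive t 1 g dg ->
  is_derive t 1 (fun x => g x + b) dg.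
Proof.
move=> H; apply: is_derive_eq (is_deriveD H (is_derive_cst b t (1 : R))) _.
by rewrite addr0.
Qed.

Lemma is_derive_idsqr (t : R) : is_derive t 1 (fun x : R => x ^+ 2) (2 * t).
Proof.
by rewrite -[X in is_derive _ _ _ X]mulr1; exact: is_derive_sqr (is_derive_id t (1 : R)).
Qed.

Lemma is_derive_scale (k t : R) : is_derive t 1 (fun x : R => x * k) k.
Proof.
have H := is_deriveM (is_derive_id t (1 : R)) (is_derive_cst k t (1 : R)).
apply: is_derive_eq H _.
by rewrite /GRing.scale /= mulr0 mulr1 add0r.
Qed.

Lemma is_derive_field0 (n c : R) (f f0 : pt3 -> R) (y z x : R) :
  is_derive x 1 (fun t => f (t, y, z)) (f0 (x, y, z)) ->
  is_derive x 1 (fun t => field_comp n c (@cx R) f (t, y, z))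
    (field_deriv n e^-1 0 c (@cx R) f f0 (x, y, z)).
Proof.
move=> df.
have dS : is_derive x 1 (fun t => S (t, y, z)) (x / S (x, y, z)).
  apply: is_derive_sqrt_sqr; last first.
    by rewrite -sqrtr_gt0; exact: (jbracket_gt0 (x, y, z)).
  exact: (is_derive_addr (z ^+ 2) (is_derive_addr (y ^+ 2) (is_derive_addl 1 (is_derive_idsqr x)))).
exact: (@is_derive_weighted_field R n lam (2 * mu / lam) (fun t => S (t, y, z)) (fun t => t * e^-1)
  (fun=> y * ecc) (fun t => f (t, y, z) - c) e^-1 0 _ x (jbracket_gt0 (x, y, z)) dS
  (is_derive_scale e^-1 x) (is_derive_cst_id (y * ecc) x) (is_derive_subc c df)).
Qed.

Lemma is_derive_field1 (n c : R) (f f1 : pt3 -> R) (x z y : R) :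
  is_derive y 1 (fun t => f (x, t, z)) (f1 (x, y, z)) ->
  is_derive y 1 (fun t => field_comp n c (@cy R) f (x, t, z))
    (field_deriv n 0 ecc c (@cy R) f f1 (x, y, z)).
Proof.
move=> df.
have dS : is_derive y 1 (fun t => S (x, t, z)) (y / S (x, y, z)).
  apply: is_derive_sqrt_sqr; last first.
    by rewrite -sqrtr_gt0; exact: (jbracket_gt0 (x, y, z)).
  exact: (is_derive_addr (z ^+ 2) (is_derive_addl (1 + x ^+ 2) (is_derive_idsqr y))).
exact: (@is_derive_weighted_field R n lam (2 * mu / lam) (fun t => S (x, t, z)) (fun=> x / e)
  (fun t => t * ecc) (fun t => f (x, t, z) - c) 0 ecc _ y (jbracket_gt0 (x, y, z)) dS
  (is_derive_cst_id (x / e) y) (is_derive_scale ecc y) (is_derive_subc c df)).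
Qed.

Lemma is_derive_field2 (n c : R) (f f2 : pt3 -> R) (x y z : R) :
  is_derive z 1 (fun t => f (x, y, t)) (f2 (x, y, z)) ->
  is_derive z 1 (fun t => field_comp n c (@cz R) f (x, y, t))
    (field_deriv n 0 0 c (@cz R) f f2 (x, y, z)).
Proof.
move=> df.
have dS : is_derive z 1 (fun t => S (x, y, t)) (z / S (x, y, z)).
  apply: is_derive_sqrt_sqr; last first.
    by rewrite -sqrtr_gt0; exact: (jbracket_gt0 (x, y, z)).
  exact: (is_derive_addl (1 + x ^+ 2 + y ^+ 2) (is_derive_idsqr z)).
exact: (@is_derive_weighted_field R n lam (2 * mu / lam) (fun t => S (x, y, t)) (fun=> x / e)
  (fun=> y * ecc) (fun t => f (x, y, t) - c) 0 0 _ z (jbracket_gt0 (x, y, z)) dS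
  (is_derive_cst_id (x / e) z) (is_derive_cst_id (y * ecc) z) (is_derive_subc c df)).
Qed.

Lemma continuous_cx : continuous (@cx R).
Proof. by move=> p; apply: continuous_comp; exact: cvg_fst. Qed.

Lemma continuous_cy : continuous (@cy R).
Proof. by move=> p; apply: continuous_comp; [exact: cvg_fst|exact: cvg_snd]. Qed.

Lemma continuous_cz : continuous (@cz R).
Proof. by move=> p; exact: cvg_snd. Qed.

Lemma continuous_sqr (f : pt3 -> R) : continuous f -> continuous (fun p => f p ^+ 2).
Proof.
move=> cf p; apply: (@continuous_comp _ _ _ f (fun u => u ^+ 2)); first exact: cf.
exact: exprn_continuous.
Qed.

Lemma continuous_addf (f g : pt3 -> R) : continuous f -> continuous g ->
  continuous (fun p => f p + g p).
Proof. by move=> cf cg p; apply: cvgD; [exact: cf|exact: cg]. Qed.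

Lemma continuous_subf (f g : pt3 -> R) : continuous f -> continuous g ->
  continuous (fun p => f p - g p).
Proof. by move=> cf cg p; apply: cvgB; [exact: cf|exact: cg]. Qed.

Lemma continuous_mulf (f g : pt3 -> R) : continuous f -> continuous g ->
  continuous (fun p => f p * g p).
Proof. by move=> cf cg p; apply: cvgM; [exact: cf|exact: cg]. Qed.

Lemma continuous_cstf (b : R) : continuous (fun p : pt3 => b).
Proof. by move=> p; exact: cvg_cst. Qed.

Lemma continuous_invf (f : pt3 -> R) : continuous f -> (forall p, 0 < f p) ->
  continuous (fun p => (f p)^-1).
Proof. by move=> cf f0 p; apply: cvgV; [rewrite gt_eqF|exact: cf]. Qed.

Lemma continuous_jbracket : continuous S.
Proof.
move=> p; apply: (@continuous_comp _ _ _ (fun p => 1 + cx p ^+ 2 + cy p ^+ 2 + cz p ^+ 2)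
  (@Num.sqrt R)); last exact: sqrt_continuous.
move: p; apply: continuous_addf; last exact: (continuous_sqr continuous_cz).
apply: continuous_addf; last exact: (continuous_sqr continuous_cy).
apply: continuous_addf; last exact: (continuous_sqr continuous_cx).
exact: continuous_cstf.
Qed.

Lemma smooth_nu_gt0 p : 0 < q p.
Proof. exact: lt_le_trans ltr01 (smooth_nu_ge1 e p). Qed.

Lemma continuous_smooth_nu : continuous q.
Proof.
apply: continuous_addf; last first.
  by apply: continuous_sqr; apply: continuous_mulf; [exact: continuous_cy|exact: continuous_cstf].
apply: continuous_addf; first exact: continuous_cstf.
apply: continuous_sqr; apply: continuous_subf; first exact: continuous_jbracket.
apply: continuous_mulf; [exact: continuous_cx|exact: continuous_cstf].
Qed.

Lemma continuous_potential : continuous (potential mu lam e).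
Proof.
apply: continuous_subf.
  apply: continuous_mulf; first exact: continuous_cstf.
  move=> p; apply: (@continuous_comp _ _ _ q (@ln R)); first exact: continuous_smooth_nu.
  exact: continuous_ln (smooth_nu_gt0 p).
apply: continuous_mulf; first exact: continuous_cstf.
exact: continuous_jbracket.
Qed.

Lemma continuous_weight n : continuous (weight n).
Proof.
move=> p; apply: (@continuous_comp _ _ _ (fun p => n * potential mu lam e p) (@expR R)); last exact: continuous_expR.
move: p; apply: continuous_mulf; [exact: continuous_cstf|exact: continuous_potential].
Qed.

Lemma continuous_field_deriv n u v c (X f df : pt3 -> R) : continuous X ->
  continuous f -> continuous df -> continuous (field_deriv n u v c X f df).
Proof.
move=> cX cf cdf.
have cI := continuous_invf continuous_jbracket jbracket_gt0.
have cqI := continuous_invf continuous_smooth_nu smooth_nu_gt0.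
have cV : continuous (fun p => (S p ^+ 3)^-1).
  apply: continuous_invf => [p|p]; last by rewrite exprn_gt0// jbracket_gt0.
  apply: (@continuous_comp _ _ _ S (fun x => x ^+ 3)); first exact: continuous_jbracket.
  exact: exprn_continuous.
have k b := @continuous_cstf b.
have cXS : continuous (fun p => X p / S p) := continuous_mulf cX cI.
have cg : continuous (fun p => f p - c) := continuous_subf cf (k c).
have cT : continuous (fun p => S p - cx p / e) :=
  continuous_subf continuous_jbracket (continuous_mulf continuous_cx (k e^-1)).
have cdq : continuous (fun p => 2 * (S p - cx p / e) * (X p / S p - u) + 2 * (cy p * ecc) * v) :=
  continuous_addf (continuous_mulf (continuous_mulf (k 2) cT) (continuous_subf cXS (k u)))
    (continuous_mulf (continuous_mulf (k 2) (continuous_mulf continuous_cy (k ecc))) (k v)).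
have cG : continuous (fun p => lam * ((2 * (S p - cx p / e) * (X p / S p - u)
    + 2 * (cy p * ecc) * v) / q p) - 2 * mu / lam * (X p / S p)) :=
  continuous_subf (continuous_mulf (k lam) (continuous_mulf cdq cqI))
    (continuous_mulf (k (2 * mu / lam)) cXS).
have cR : continuous (fun p => (S p)^-1 - X p ^+ 2 / S p ^+ 3) :=
  continuous_subf cI (continuous_mulf (continuous_sqr cX) cV).
have cw := @continuous_weight n.
exact: (continuous_addf
  (continuous_mulf (continuous_mulf (continuous_mulf (k 2) cg) cdf) (continuous_mulf cw cXS))
  (continuous_mulf (continuous_sqr cg) (continuous_mulf cw (continuous_addf
     (continuous_mulf (continuous_mulf (k n) cG) cXS) cR)))).
Qed.

(* The Lyapunov inequality: [- div (w X/S) / w >= n (a - K/S)] with [a = 2 mu/lam], and the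
   cross term is absorbed by AM-GM. *)
Definition lyap_K : R := 2 * mu / lam + lam * (2 + 2 / e) + 3.
(** With [a = 2 mu/lam], the drift [n a] is split: half is kept on the left-hand side, a quarter
    pays for the cross term, and wherever [S] exceeds this radius the last quarter dominates
    [n lyap_K / S]. *)
Definition lyap_radius : R := 4 * lyap_K / (2 * mu / lam).

Hypotheses (mu0 : 0 < mu) (lam0 : 0 < lam) (e01 : 0 < e < 1).

Lemma lyap_K_gt0 : 0 < lyap_K.
Proof.
have [e0 _] := andP e01; have h1 : 0 < 2 * mu / lam by rewrite divr_gt0 ?mulr_gt0.
have h2 : 0 < 2 / e by rewrite divr_gt0.
have h3 : 0 < lam * (2 + 2 / e) by rewrite mulr_gt0//; lra.
by rewrite /lyap_K; lra.
Qed.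

Lemma normr_coord_le_jbracket p : [/\ `|cx p| <= S p, `|cy p| <= S p & `|cz p| <= S p].
Proof.
have s0 := ltW (jbracket_gt0 p).
have h1 := sqr_ge0 (cx p); have h2 := sqr_ge0 (cy p); have h3 := sqr_ge0 (cz p).
by split; rewrite -(ler_pXn2r (n := 2)) ?nnegrE// jbracket_sqr real_normK ?num_real//; lra.
Qed.

(** Euler's identity for an almost homogeneous function: the sum in parentheses is
    [x . grad q = 2 q - 4 + (2/e) x/S], so dividing by [q >= 1] leaves at most [2 + 2/e], however
    anisotropic [q] is. *)
Lemma lyap_drift_le p : let s := (S p)^-1 in
  s * (cx p * (2 * (S p - cx p / e) * (cx p * s - e^-1)) +
       cy p * (2 * (S p - cx p / e) * (cy p * s) + 2 * (cy p * ecc) * ecc) +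
       cz p * (2 * (S p - cx p / e) * (cz p * s))) / q p <= (2 + 2 / e) * s.
Proof.
cbv zeta; have [e0 _] := andP e01.
have s0 := jbracket_gt0 p; have q0 := smooth_nu_gt0 p; have q1 := smooth_nu_ge1 e p.
have i0 : 0 < (S p)^-1 by rewrite invr_gt0.
rewrite -mulrA [leLHS]mulrC ler_pM2r// ler_pdivrMr//.
have j2 := jbracket_sqr p.
have E : cx p * (2 * (S p - cx p / e) * (cx p * (S p)^-1 - e^-1)) +
       cy p * (2 * (S p - cx p / e) * (cy p * (S p)^-1) + 2 * (cy p * ecc) * ecc) +
       cz p * (2 * (S p - cx p / e) * (cz p * (S p)^-1)) =
     2 * (S p - cx p / e) * ((S p)^-1 * (cx p ^+ 2 + cy p ^+ 2 + cz p ^+ 2) - cx p / e)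
     + 2 * (cy p * ecc) ^+ 2 by ring.
have j3 : cx p ^+ 2 + cy p ^+ 2 + cz p ^+ 2 = S p ^+ 2 - 1 by rewrite j2; ring.
have E2 : 2 * (S p - cx p / e) * ((S p)^-1 * (S p ^+ 2 - 1) - cx p / e)
     + 2 * (cy p * ecc) ^+ 2 = 2 * q p - 4 + 2 / e * (cx p / S p).
  by rewrite /smooth_nu; field; rewrite (gt_eqF s0) (gt_eqF e0).
rewrite E j3 E2.
have x1 : cx p / S p <= 1.
  rewrite ler_pdivrMr// mul1r; have [h _ _] := normr_coord_le_jbracket p.
  exact: le_trans (ler_norm _) h.
have e2 : 0 < 2 / e by rewrite divr_gt0.
have h1 : 2 / e * (cx p / S p) <= 2 / e by rewrite ler_piMr// ltW.
have h2 : 2 / e <= 2 / e * q p by rewrite ler_peMr// ltW.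
by rewrite mulrDl; lra.
Qed.

Lemma lyapunov_field (n c : R) (f f0 f1 f2 : pt3 -> R) p : 1 <= n ->
  field_deriv n e^-1 0 c (@cx R) f f0 p + field_deriv n 0 ecc c (@cy R) f f1 p +
    field_deriv n 0 0 c (@cz R) f f2 p +
    n * (mu / lam) * ((f p - c) ^+ 2 * weight n p) <=
  2 * lam / mu * ((f0 p ^+ 2 + f1 p ^+ 2 + f2 p ^+ 2) * weight n p) +
    n * lyap_K * (\1_(cube lyap_radius) p * ((f p - c) ^+ 2 * weight n p)).
Proof.
move=> n1; have n0 : 0 < n by lra.
set a := 2 * mu / lam; have a0 : 0 < a by rewrite divr_gt0 ?mulr_gt0.
have s0 := jbracket_gt0 p; set s := (S p)^-1; have i0 : 0 < s by rewrite invr_gt0.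
have s1 : s <= 1 by rewrite invf_le1//; exact: jbracket_ge1.
have [e0 _] := andP e01.
have K0 := lyap_K_gt0.
have w0 : 0 < weight n p by exact: expR_gt0.
set w := weight n p in w0 *; set g := f p - c.
pose x := cx p * s; pose y := cy p * s; pose z := cz p * s.
have r2 : x ^+ 2 + y ^+ 2 + z ^+ 2 = 1 - s ^+ 2.
  have -> : x ^+ 2 + y ^+ 2 + z ^+ 2 = s ^+ 2 * (S p ^+ 2 - 1).
    by rewrite jbracket_sqr /x /y /z; ring.
  by rewrite /s; field; rewrite gt_eqF.
pose dq0 := 2 * (S p - cx p / e) * (x - e^-1).
pose dq1 := 2 * (S p - cx p / e) * y + 2 * (cy p * ecc) * ecc.
pose dq2 := 2 * (S p - cx p / e) * z.
have E : field_deriv n e^-1 0 c (@cx R) f f0 p + field_deriv n 0 ecc c (@cy R) f f1 p +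
    field_deriv n 0 0 c (@cz R) f f2 p =
   w * (2 * g * (f0 p * x + f1 p * y + f2 p * z) + g ^+ 2 *
     (n * (lam * (s * (cx p * dq0 + cy p * dq1 + cz p * dq2) / q p) - a * (1 - s ^+ 2))
      + 3 * s - s * (1 - s ^+ 2))).
  rewrite -{1}r2 -r2 /field_deriv -/w -/g -/a /dq0 /dq1 /dq2 /x /y /z /s.
  by field; rewrite (gt_eqF s0) (gt_eqF (smooth_nu_gt0 p)) (gt_eqF e0).
rewrite E.
have D1 : s * (cx p * dq0 + cy p * dq1 + cz p * dq2) / q p <= (2 + 2 / e) * s.
  exact: lyap_drift_le.
set Dq := s * _ / _ in D1 *.
set d := f0 p ^+ 2 + f1 p ^+ 2 + f2 p ^+ 2.
have d0 : 0 <= d by rewrite !addr_ge0 ?sqr_ge0.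
have a2 : 2 * lam / mu = 4 / a by rewrite /a; field; rewrite (gt_eqF mu0) (gt_eqF lam0).
have a1 : mu / lam = a / 2 by rewrite /a; field; rewrite (gt_eqF lam0).
rewrite a1 a2.
have ss : s ^+ 2 <= s by rewrite expr2 ler_piMr// ltW.
(* The three summands of [lyap_K] come from [a s^2 <= a s], from the logarithm, and from the term
   [3/S] in the divergence of [x/S]; the last is multiplied by [n >= 1] for uniformity. *)
have divle : n * (lam * Dq - a * (1 - s ^+ 2)) + 3 * s - s * (1 - s ^+ 2) <=
    n * (lyap_K * s - a).
  have h1 : lam * Dq <= lam * ((2 + 2 / e) * s) by rewrite ler_pM2l.
  have h2 : a * s ^+ 2 <= a * s by rewrite ler_pM2l.
  have h3 : 3 * s <= n * (3 * s) by rewrite ler_peMl// mulr_ge0// ltW.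
  have h4 : 0 <= s * (1 - s ^+ 2) by rewrite mulr_ge0 ?(ltW i0)//; lra.
  have h5 : n * (lam * Dq - a * (1 - s ^+ 2)) <=
     n * (lam * ((2 + 2 / e) * s) - a + a * s) by rewrite ler_pM2l//; lra.
  have -> : n * (lyap_K * s - a) = n * (lam * ((2 + 2 / e) * s) - a + a * s) + n * (3 * s).
    by rewrite /lyap_K -/a; ring.
  lra.
have cross : 2 * g * (f0 p * x + f1 p * y + f2 p * z) <= n * (a / 4) * g ^+ 2 + 4 / a * d.
  have k0 : 0 < n * (a / 4) by rewrite mulr_gt0// divr_gt0.
  have one t v : 2 * g * (t * v) <= n * (a / 4) * (g ^+ 2 * v ^+ 2) + (n * (a / 4))^-1 * t ^+ 2.
    rewrite -subr_ge0.
    have -> : n * (a / 4) * (g ^+ 2 * v ^+ 2) + (n * (a / 4))^-1 * t ^+ 2 - 2 * g * (t * v)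
      = (n * (a / 4))^-1 * (n * (a / 4) * g * v - t) ^+ 2.
      by field; rewrite (gt_eqF a0) (gt_eqF n0).
    by rewrite mulr_ge0 ?sqr_ge0// invr_ge0 ltW.
  have h : 2 * g * (f0 p * x + f1 p * y + f2 p * z) <=
      n * (a / 4) * (g ^+ 2 * (1 - s ^+ 2)) + (n * (a / 4))^-1 * d.
    by rewrite -r2 /d; have := one (f0 p) x; have := one (f1 p) y; have := one (f2 p) z; lra.
  have h1 : n * (a / 4) * (g ^+ 2 * (1 - s ^+ 2)) <= n * (a / 4) * g ^+ 2.
    by rewrite ler_pM2l// ler_piMr ?sqr_ge0//; have := sqr_ge0 s; lra.
  have h2 : (n * (a / 4))^-1 * d <= 4 / a * d.
    apply: ler_wpM2r => //; rewrite invfM invf_div.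
    by apply: ler_piMl; [rewrite divr_ge0 ?(ltW a0)|rewrite invf_le1].
  lra.
have g2 := sqr_ge0 g.
have fin : 2 * g * (f0 p * x + f1 p * y + f2 p * z) + g ^+ 2 *
     (n * (lam * Dq - a * (1 - s ^+ 2)) + 3 * s - s * (1 - s ^+ 2)) + n * (a / 2) * g ^+ 2 <=
    4 / a * d + n * lyap_K * (\1_(cube lyap_radius) p * g ^+ 2).
  have h1 : g ^+ 2 * (n * (lam * Dq - a * (1 - s ^+ 2)) + 3 * s - s * (1 - s ^+ 2)) <=
    g ^+ 2 * (n * (lyap_K * s - a)) by apply: ler_wpM2l.
  suff : g ^+ 2 * (n * (lyap_K * s - a)) + n * (a / 4) * g ^+ 2 + n * (a / 2) * g ^+ 2
     <= n * lyap_K * (\1_(cube lyap_radius) p * g ^+ 2) by lra.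
  have -> : g ^+ 2 * (n * (lyap_K * s - a)) + n * (a / 4) * g ^+ 2 + n * (a / 2) * g ^+ 2 =
     (n * g ^+ 2) * (lyap_K * s - a / 4) by field.
  have ng : 0 <= n * g ^+ 2 by rewrite mulr_ge0// ltW.
  rewrite indicE; have [pQ|pQ] := boolP (p \in cube lyap_radius).
    rewrite mul1r (_ : n * lyap_K * g ^+ 2 = n * g ^+ 2 * lyap_K); last by ring.
    apply: ler_wpM2l => //; have : lyap_K * s <= lyap_K by rewrite ler_piMr// ltW.
    lra.
  rewrite mul0r mulr0; apply: mulr_ge0_le0 => //.
  (* Outside the cube some coordinate, hence [S], exceeds the radius; the contrary inequality would
     put [p] inside. *)
  rewrite subr_le0 leNgt; apply/negP => hS.
  move/negP : pQ; apply; apply/mem_set/cubeP.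
  have Slt : S p <= lyap_radius.
    rewrite /lyap_radius -/a ler_pdivlMr//.
    have : a / 4 * S p <= lyap_K.
      have -> : lyap_K = lyap_K * s * S p by rewrite /s mulfVK// gt_eqF.
      by rewrite ler_pM2r// ltW.
    lra.
  have [h2 h3 h4] := normr_coord_le_jbracket p.
  by split; rewrite -ler_norml (le_trans _ Slt).
rewrite -(ler_pM2l w0) in fin; move: fin; lra.
Qed.

End WeightedField.

(** * The weighted Poincare inequality *)


Section GlobalPoincare.
Variables (R : realType) (mu lam e : R).
Hypotheses (mu0 : 0 < mu) (lam0 : 0 < lam) (e01 : 0 < e < 1).
Local Notation pt3 := (pt3 R).
Local Notation leb3 := (@leb3 R).
Local Notation w := (weight mu lam e).
Local Notation K := (lyap_K mu lam e).
Local Notation rad := (lyap_radius mu lam e).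

Lemma integral_indicM (D : set pt3) (h : pt3 -> R) :
  (\int[leb3]_p (\1_D p * h p)%:E = \int[leb3]_(p in D) (h p)%:E)%E.
Proof.
rewrite [RHS]integral_mkcond; apply: eq_integral => p _.
by rewrite patchE indicE; case: (p \in D); rewrite ?mul1r ?mul0r.
Qed.

(** Each component of the field has the sign of its coordinate, which is the comparison between
    opposite faces required by [divergence_cube_le]. *)
Lemma field_comp_sign n c (f X : pt3 -> R) (p q : pt3) : X p <= 0 -> 0 <= X q ->
  field_comp mu lam e n c X f p <= field_comp mu lam e n c X f q.
Proof.
move=> Xp Xq; apply: (@le_trans _ _ 0).
  apply: mulr_ge0_le0; first exact: sqr_ge0.
  apply: mulr_ge0_le0; first exact: expR_ge0.
  by apply: mulr_le0_ge0 => //; rewrite invr_ge0 ltW// jbracket_gt0.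
apply: mulr_ge0; first exact: sqr_ge0.
apply: mulr_ge0; first exact: expR_ge0.
by apply: divr_ge0 => //; rewrite ltW// jbracket_gt0.
Qed.

Section Fixed.
Variables (n c : R) (f f0 f1 f2 : pt3 -> R).
Hypotheses (n1 : 1 <= n) (df : C1lines f f0 f1 f2) (cf : continuous f)
  (cf0 : continuous f0) (cf1 : continuous f1) (cf2 : continuous f2).

Local Notation d := (fun p => f0 p ^+ 2 + f1 p ^+ 2 + f2 p ^+ 2).

Let d0 p : 0 <= d p.
Proof. by rewrite !addr_ge0 ?sqr_ge0. Qed.

Let cd : continuous d.
Proof. by do 2?[apply: continuous_addf]; exact: continuous_sqr. Qed.

Let cg : continuous (fun p => (f p - c) ^+ 2 * w n p).
Proof.
apply: continuous_mulf; last exact: continuous_weight.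
by apply: continuous_sqr; apply: continuous_subf => //; exact: continuous_cstf.
Qed.

Let cdw : continuous (fun p => d p * w n p).
Proof. by apply: continuous_mulf => //; exact: continuous_weight. Qed.

Let g0 p : 0 <= (f p - c) ^+ 2 * w n p.
Proof. by rewrite mulr_ge0 ?sqr_ge0// expR_ge0. Qed.

Let dw0 p : 0 <= d p * w n p.
Proof. by rewrite mulr_ge0// expR_ge0. Qed.

Let mg := continuous_measurable3 cg.
Let mdw := continuous_measurable3 cdw.

Let n0 : 0 < n. Proof. exact: lt_le_trans ltr01 n1. Qed.

(** On the right the gradient term is extended to the whole space and the remainder to the fixed
    cube, so the bound does not depend on [L] and survives the exhaustion by cubes. *)
Lemma lyapunov_cube (L : R) : 0 <= L ->
  ((n * (mu / lam))%:E * \int[leb3]_(p in cube L) ((f p - c) ^+ 2 * w n p)%:E <=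
   (2 * lam / mu)%:E * \int[leb3]_p (d p * w n p)%:E +
   (n * K)%:E * \int[leb3]_(p in cube rad) ((f p - c) ^+ 2 * w n p)%:E)%E.
Proof.
move=> L0; have [df0 df1 df2] := df.
have K0 := lyap_K_gt0 mu0 lam0 e01.
have mQ := measurable_cube L.
have c1 : 0 <= n * (mu / lam) by rewrite mulr_ge0 ?divr_ge0// ltW.
have c2 : 0 <= 2 * lam / mu by rewrite divr_ge0 ?mulr_ge0// ltW.
have c3 : 0 <= n * K by rewrite mulr_ge0// ltW.
have mind : measurable_fun [set: pt3] (fun p => \1_(cube rad) p * ((f p - c) ^+ 2 * w n p) : R).
  by apply: measurable_funM => //; apply: measurable_indic; exact: measurable_cube.
have ind0 p : 0 <= \1_(cube rad) p * ((f p - c) ^+ 2 * w n p).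
  by rewrite mulr_ge0// indicE.
have m1 : measurable_fun [set: pt3] (fun p => n * (mu / lam) * ((f p - c) ^+ 2 * w n p)).
  exact: measurable_funM.
have m2 : measurable_fun [set: pt3] (fun p => 2 * lam / mu * (d p * w n p)).
  exact: measurable_funM.
have m3 : measurable_fun [set: pt3]
    (fun p => n * K * (\1_(cube rad) p * ((f p - c) ^+ 2 * w n p))).
  exact: measurable_funM.
have div := @divergence_cube_le R (field_comp mu lam e n c (@cx R) f)
  (field_comp mu lam e n c (@cy R) f) (field_comp mu lam e n c (@cz R) f)
  (field_deriv mu lam e n e^-1 0 c (@cx R) f f0)
  (field_deriv mu lam e n 0 (ecc e) c (@cy R) f f1)
  (field_deriv mu lam e n 0 0 c (@cz R) f f2)
  (fun p => n * (mu / lam) * ((f p - c) ^+ 2 * w n p))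
  (fun p => 2 * lam / mu * (d p * w n p) +
    n * K * (\1_(cube rad) p * ((f p - c) ^+ 2 * w n p))) L L0.
have {}div : (\int[leb3]_(p in cube L) (n * (mu / lam) * ((f p - c) ^+ 2 * w n p))%:E <=
   \int[leb3]_(p in cube L) (2 * lam / mu * (d p * w n p) +
    n * K * (\1_(cube rad) p * ((f p - c) ^+ 2 * w n p)))%:E)%E.
  apply: div.
  - apply: continuous_field_deriv => //; exact: continuous_cx.
  - apply: continuous_field_deriv => //; exact: continuous_cy.
  - apply: continuous_field_deriv => //; exact: continuous_cz.
  - exact: m1.
  - exact: measurable_funD.
  - by move=> y z x; apply: is_derive_field0.
  - by move=> x z y; apply: is_derive_field1.
  - by move=> x y z; apply: is_derive_field2.
  - by move=> y z; apply: field_comp_sign; rewrite /cx //= oppr_le0.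
  - by move=> x z; apply: field_comp_sign; rewrite /cy //= oppr_le0.
  - by move=> x y; apply: field_comp_sign; rewrite /cz //= oppr_le0.
  - by move=> p; rewrite mulr_ge0.
  - by move=> p; rewrite addr_ge0// mulr_ge0.
  - by move=> p; exact: lyapunov_field.
rewrite -integralZ_EFin//; last exact: measurable_funTS.
apply: le_trans div _.
have mv : measurable_fun [set: pt3] (fun p => (2 * lam / mu * (d p * w n p) +
    n * K * (\1_(cube rad) p * ((f p - c) ^+ 2 * w n p)))%:E).
  by apply/measurable_EFinP; exact: measurable_funD.
apply: (@le_trans _ _ (\int[leb3]_p (2 * lam / mu * (d p * w n p) +
    n * K * (\1_(cube rad) p * ((f p - c) ^+ 2 * w n p)))%:E)%E).
  apply: ge0_subset_integral => //.
  by move=> p _; rewrite lee_fin addr_ge0// mulr_ge0.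
rewrite integralD_EFin//; last 2 first.
- by move=> p _; rewrite mulr_ge0.
- by move=> p _; rewrite mulr_ge0.
by rewrite !integralZ_EFin// integral_indicM.
Qed.

Lemma integral_le_cubes (h : pt3 -> R) (b : \bar R) : measurable_fun [set: pt3] h ->
  (forall p, 0 <= h p) ->
  (forall L, 0 <= L -> (\int[leb3]_(p in cube L) (h p)%:E <= b)%E) ->
  (\int[leb3]_p (h p)%:E <= b)%E.
Proof.
move=> mh h0 H.
have U : \bigcup_k cube (k%:R : R) = [set: pt3].
  apply/seteqP; split => // p _.
  exists (Num.truncn (`|cx p| + `|cy p| + `|cz p|)).+1 => //; apply/cubeP.
  have := truncnS_gt (`|cx p| + `|cy p| + `|cz p|).
  have a1 := normr_ge0 (cx p); have a2 := normr_ge0 (cy p); have a3 := normr_ge0 (cz p).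
  by move=> ht; split; rewrite -ler_norml; lra.
have cvgI : (\int[leb3]_(p in cube (k%:R : R)) (h p)%:E @[k --> \oo] -->
    \int[leb3]_(p in \bigcup_k cube (k%:R : R)) (h p)%:E)%E.
  apply: ge0_nondecreasing_set_cvg_integral.
  - move=> k l kl; apply/subsetPset => p /cubeP[h1 h2 h3]; apply/cubeP.
    have kl' : (k%:R : R) <= l%:R by rewrite ler_nat.
    by split; apply/andP; split; lra.
  - by move=> k; exact: measurable_cube.
  - by move=> k; apply/measurable_EFinP; exact: measurable_funTS.
  - by move=> k p _; rewrite lee_fin.
rewrite U in cvgI; rewrite -(cvg_lim _ cvgI)//.
apply: lime_le; first by apply/cvg_ex; eexists; exact: cvgI.
by apply: nearW => k; exact: H.
Qed.

End Fixed.

(** The [c] of the unweighted inequality on the fixed cube serves globally. If [P] bounds the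
    potential there, the weight lies between [exp(-n P)] and [exp(n P)], hence [B = 2 P]. Dividing
    by [n mu/lam] cancels the [n] of the remainder, and [n >= 1] absorbs the gradient term, so [A]
    is independent of [n]. *)
Lemma global_poincare : exists A B : R, [/\ 0 < A, 0 <= B &
  forall (n : R) (f f0 f1 f2 : pt3 -> R), 1 <= n -> C1lines f f0 f1 f2 -> continuous f ->
    continuous f0 -> continuous f1 -> continuous f2 -> exists c : R,
    (\int[leb3]_p ((f p - c) ^+ 2 * w n p)%:E <= (A * expR (B * n))%:E *
     \int[leb3]_p ((f0 p ^+ 2 + f1 p ^+ 2 + f2 p ^+ 2) * w n p)%:E)%E].
Proof.
have K0 := lyap_K_gt0 mu0 lam0 e01.
have rad0 : 0 < rad by apply: divr_gt0; [rewrite mulr_gt0|rewrite divr_gt0 ?mulr_gt0].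
have [P P0 HP] := bounded_on_cube rad (@continuous_potential R mu lam e).
pose k := 10 * (2 * rad) ^+ 2; have k0 : 0 < k by apply: mulr_gt0 => //; apply: exprn_gt0; exact: mulr_gt0.
have ml0 : 0 < mu / lam by rewrite divr_gt0.
pose A := (2 * lam / mu + K * k) / (mu / lam).
have A0 : 0 < A.
  apply: divr_gt0 => //; apply: addr_gt0; last exact: mulr_gt0.
  by apply: divr_gt0 => //; exact: mulr_gt0.
exists A, (2 * P); split => //; first by rewrite mulr_ge0.
move=> n f f0 f1 f2 n1 df cf cf0 cf1 cf2.
have n0 : 0 < n by exact: lt_le_trans ltr01 n1.
have [c Hc] := poincare_cube rad0 df cf cf0 cf1 cf2; exists c.
rewrite -/k in Hc.
set d := fun p => f0 p ^+ 2 + f1 p ^+ 2 + f2 p ^+ 2.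
set J := (X in (_ <= _ * X)%E).
have d0 p : 0 <= d p by rewrite !addr_ge0 ?sqr_ge0.
have md : measurable_fun [set: pt3] d.
  by apply: continuous_measurable3; do 2?[apply: continuous_addf]; exact: continuous_sqr.
have mw : measurable_fun [set: pt3] (w n).
  by apply: continuous_measurable3; exact: continuous_weight.
have mg : measurable_fun [set: pt3] (fun p => (f p - c) ^+ 2).
  by apply: measurable_funX; apply: measurable_funB => //; exact: continuous_measurable3.
have w0 p : 0 <= w n p by exact: expR_ge0.
have J0 : (0 <= J)%E by apply: integral_ge0_EFin => p _; rewrite mulr_ge0// ?d0.
have mQ := measurable_cube rad.
have mdw : measurable_fun [set: pt3] (fun p => d p * w n p) by exact: measurable_funM.
have wQ p : cube rad p -> expR (- (n * P)) <= w n p <= expR (n * P).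
  move=> /HP; rewrite ler_norml => /andP[h1 h2].
  by rewrite /weight !ler_expR -mulrN !ler_pM2l// h1 h2.
have loc : (\int[leb3]_(p in cube rad) ((f p - c) ^+ 2 * w n p)%:E <=
    (k * expR (2 * P * n))%:E * J)%E.
  apply: (@le_trans _ _ ((expR (n * P))%:E * \int[leb3]_(p in cube rad) ((f p - c) ^+ 2)%:E)%E).
    rewrite -integralZ_EFin ?expR_ge0//; last 2 first.
    - exact: measurable_funTS.
    - by move=> p _; exact: sqr_ge0.
    apply: integral_le_EFin => //.
    - by apply: measurable_funTS; exact: measurable_funM.
    - by apply: measurable_funTS; exact: measurable_funM.
    - by move=> p _; rewrite mulr_ge0 ?sqr_ge0.
    - by move=> p /wQ/andP[_ h]; rewrite mulrC ler_wpM2r ?sqr_ge0.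
  apply: le_trans (lee_wpmul2l _ Hc) _; first by rewrite lee_fin expR_ge0.
  have -> : k * expR (2 * P * n) = expR (n * P) * (k * expR (n * P)).
    by rewrite (_ : 2 * P * n = n * P + n * P) ?expRD; ring.
  rewrite (EFinM (expR _)) -muleA; apply: lee_wpmul2l; first by rewrite lee_fin expR_ge0.
  rewrite (EFinM k) -muleA; apply: lee_wpmul2l; first by rewrite lee_fin ltW.
  rewrite -integralZ_EFin ?expR_ge0//; last by move=> p _; rewrite mulr_ge0// ?d0.
  apply: (@le_trans _ _ (\int[leb3]_(p in cube rad) (expR (n * P) * (d p * w n p))%:E)%E).
    apply: integral_le_EFin => //.
    - exact: measurable_funTS.
    - by apply: measurable_funTS; apply: measurable_funM.
    - by move=> p _; exact: d0.
    - move=> p /wQ/andP[h _]; rewrite -[leLHS]mulr1.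
      rewrite (_ : expR (n * P) * (d p * w n p) = d p * (expR (n * P) * w n p)); last by ring.
      apply: ler_wpM2l; first exact: d0.
      by rewrite -(expR0 R) -(subrr (n * P)) expRD ler_pM2l ?expR_gt0.
  apply: ge0_subset_integral => //.
  - by apply/measurable_EFinP; exact: measurable_funM.
  - by move=> p _; rewrite lee_fin !mulr_ge0 ?expR_ge0.
apply: integral_le_cubes => [||L L0].
- exact: measurable_funM.
- by move=> p; rewrite mulr_ge0 ?sqr_ge0.
have c1 : 0 < n * (mu / lam) by rewrite mulr_gt0.
rewrite -(@lee_pmul2l _ (n * (mu / lam))%:E)// ?lte_fin//.
apply: le_trans (lyapunov_cube c n1 df cf cf0 cf1 cf2 L0) _.
rewrite -/d -/J muleA -EFinM.
have nK : (0 <= (n * K)%:E :> \bar R)%E by rewrite lee_fin mulr_ge0 ?ltW.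
apply: (@le_trans _ _ ((2 * lam / mu)%:E * J + (n * K)%:E * ((k * expR (2 * P * n))%:E * J))%E).
  by apply: leeD => //; exact: lee_wpmul2l.
have c2 : 0 <= 2 * lam / mu by apply: divr_ge0; [apply: mulr_ge0 => //|]; exact: ltW.
have c3 : 0 <= n * K * (k * expR (2 * P * n)).
  by apply: mulr_ge0; apply: mulr_ge0; rewrite ?expR_ge0//; exact: ltW.
rewrite muleA -EFinM -ge0_muleDl ?lee_fin//.
apply: lee_wpmul2r => //; rewrite -EFinD lee_fin.
have -> : n * (mu / lam) * (A * expR (2 * P * n)) =
   n * expR (2 * P * n) * (2 * lam / mu) + n * K * (k * expR (2 * P * n)).
  by rewrite /A; field; rewrite (gt_eqF mu0) (gt_eqF lam0).
rewrite lerD2r ler_peMl//.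
have : 1 <= expR (2 * P * n) by rewrite -expR0 ler_expR; apply: mulr_ge0; [exact: mulr_ge0|exact: ltW].
move=> h; rewrite -[leLHS]mulr1; apply: ler_pM => //.
Qed.

End GlobalPoincare.

(** * Test functions and measurability of the drift *)


Section CkCalculus.
Variable R : realType.
Local Notation pt3 := (pt3 R).
Implicit Types (f g : pt3 -> R) (s : seq nat).

Lemma upd3_coord3 (p : pt3) i : upd3 p i (coord3 p i) = p.
Proof. by case: p => [[x y] z]; case: i => [|[|i]]. Qed.

(** The last entry of the list is differentiated first; peeling it off lets [Ck k.+1] be reduced to
    [Ck k] of the first partial derivatives. *)
Lemma pdiffs_rcons s i f : pdiffs (rcons s i) f = pdiffs s (pdiff i f).
Proof. by elim: s => //= j s ->. Qed.

Lemma Ck_continuous k f : Ck k f -> continuous f.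
Proof. by move=> [+ _]; exact: (fun H => H [::] isT isT). Qed.

Lemma Ck_pdiff_exists k f i p : Ck k.+1 f -> dir3 i -> pdiff_exists i f p.
Proof. by move=> [_ +] di; move=> /(_ [::] i isT isT di). Qed.

Lemma Ck_pdiff k f i : Ck k.+1 f -> dir3 i -> Ck k (pdiff i f).
Proof.
move=> [cf df] di; split => [s ds ss|s j ds ss dj].
  by rewrite -pdiffs_rcons; apply: cf; rewrite ?all_rcons ?di// size_rcons.
by rewrite -pdiffs_rcons; apply: df; rewrite ?all_rcons ?di// size_rcons.
Qed.

Lemma Ck_intro k f : continuous f -> (forall i p, dir3 i -> pdiff_exists i f p) ->
  (forall i, dir3 i -> Ck k (pdiff i f)) -> Ck k.+1 f.
Proof.
move=> cf ef df; split.
  elim/last_ind => [//|s i _]; rewrite all_rcons size_rcons => /andP[di ds] ss.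
  by rewrite pdiffs_rcons; apply: (df i di).1.
elim/last_ind => [|s j _] i; first by move=> _ _ di p; exact: ef.
rewrite all_rcons size_rcons => /andP[dj ds] ss di p.
by rewrite pdiffs_rcons; apply: (df j dj).2.
Qed.

Lemma Ck0 f : continuous f -> Ck 0 f.
Proof. by move=> cf; split => [[|i s]//|s i]; rewrite ltn0. Qed.

Lemma CkW k f : Ck k.+1 f -> Ck k f.
Proof.
move=> [cf df]; split => [s ds ss|s i ds ss di].
  by apply: cf => //; exact: leqW.
by apply: df => //; exact: ltnW.
Qed.

Lemma pdiff_add i f g : (forall p, pdiff_exists i f p) -> (forall p, pdiff_exists i g p) ->
  pdiff i (fun p => f p + g p) = (fun p => pdiff i f p + pdiff i g p).
Proof.
by move=> ef eg; apply/funext => p; rewrite /pdiff !derive1E deriveD//; [exact: ef|exact: eg].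
Qed.

Lemma pdiff_mul i f g : (forall p, pdiff_exists i f p) -> (forall p, pdiff_exists i g p) ->
  pdiff i (fun p => f p * g p) = (fun p => f p * pdiff i g p + g p * pdiff i f p).
Proof.
move=> ef eg; apply/funext => p; rewrite /pdiff !derive1E deriveM//; [|exact: ef|exact: eg].
by rewrite !upd3_coord3.
Qed.

Lemma pdiff_exists_mul i f g p : pdiff_exists i f p -> pdiff_exists i g p ->
  pdiff_exists i (fun p => f p * g p) p.
Proof. by move=> ef eg; apply: derivableM. Qed.

Lemma Ck_add k f g : Ck k f -> Ck k g -> Ck k (fun p => f p + g p).
Proof.
elim: k f g => [|k IH] f g Cf Cg.
  by apply: Ck0; apply: continuous_addf; apply: Ck_continuous; [exact: Cf|exact: Cg].
apply: Ck_intro.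
- by apply: continuous_addf; apply: Ck_continuous; [exact: Cf|exact: Cg].
- move=> i p di.
  by apply: derivableD; [exact: Ck_pdiff_exists Cf di|exact: Ck_pdiff_exists Cg di].
- move=> i di.
  rewrite (pdiff_add (fun p => @Ck_pdiff_exists _ _ i p Cf di) (fun p => @Ck_pdiff_exists _ _ i p Cg di)).
  by apply: IH; exact: Ck_pdiff.
Qed.

Lemma Ck_mul k f g : Ck k f -> Ck k g -> Ck k (fun p => f p * g p).
Proof.
elim: k f g => [|k IH] f g Cf Cg.
  by apply: Ck0; apply: continuous_mulf; apply: Ck_continuous; [exact: Cf|exact: Cg].
apply: Ck_intro.
- by apply: continuous_mulf; apply: Ck_continuous; [exact: Cf|exact: Cg].
- move=> i p di.
  by apply: pdiff_exists_mul; [exact: Ck_pdiff_exists Cf di|exact: Ck_pdiff_exists Cg di].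
- move=> i di.
  rewrite (pdiff_mul (fun p => @Ck_pdiff_exists _ _ i p Cf di) (fun p => @Ck_pdiff_exists _ _ i p Cg di)).
  by apply: Ck_add; apply: IH; do ?[exact: CkW|exact: Ck_pdiff].
Qed.

Lemma Ccinf_mul f g : Ccinf f -> Ccinf g -> Ccinf (fun p => f p * g p).
Proof.
move=> [Cf [r Hr]] [Cg _]; split; first by move=> k; exact: Ck_mul.
by exists r => p /Hr ->; rewrite mul0r.
Qed.

Lemma pdiff_sqr f i : Ck 1 f -> dir3 i ->
  pdiff i (fun p => f p * f p) = (fun p => f p * pdiff i f p + f p * pdiff i f p).
Proof.
move=> Cf di; have ef p := @Ck_pdiff_exists _ _ i p Cf di; exact: (pdiff_mul ef ef).
Qed.

Lemma pdiff2_sqr f i p : Ck 2 f -> dir3 i ->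
  pdiffs [:: i; i] (fun p => f p * f p) p = 2 * (f p * pdiffs [:: i; i] f p) + 2 * pdiff i f p ^+ 2.
Proof.
move=> Cf di; have Cdf := Ck_pdiff Cf di.
rewrite /= (pdiff_sqr (CkW Cf) di).
have e1 q : pdiff_exists i f q by exact: Ck_pdiff_exists Cf di.
have e2 q : pdiff_exists i (pdiff i f) q by exact: Ck_pdiff_exists Cdf di.
have e3 q := pdiff_exists_mul (e1 q) (e2 q).
rewrite (pdiff_add e3 e3) (pdiff_mul e1 e2); ring.
Qed.

Lemma C1lines_pdiff f : Ck 1 f -> C1lines f (pdiff 0 f) (pdiff 1 f) (pdiff 2 f).
Proof.
move=> Cf; split.
- move=> y z x; have E := @Ck_pdiff_exists 0 f 0 (x, y, z) Cf isT.
  by rewrite /pdiff derive1E; exact/derivableP.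
- move=> x z y; have E := @Ck_pdiff_exists 0 f 1 (x, y, z) Cf isT.
  by rewrite /pdiff derive1E; exact/derivableP.
- move=> x y z; have E := @Ck_pdiff_exists 0 f 2 (x, y, z) Cf isT.
  by rewrite /pdiff derive1E; exact/derivableP.
Qed.

Lemma compact_support_bounded f : continuous f -> compact_support f ->
  exists B, forall p, `|f p| <= B.
Proof.
move=> cf [r Hr]; have [B B0 HB] := bounded_on_cube `|r| cf.
exists B => p; have [pr|pr] := ltP r (norm3 p); first by rewrite Hr ?normr0.
apply: HB; apply/cubeP.
have {}pr : norm3 p <= `|r| by exact: le_trans pr (ler_norm _).
have h1 := sqr_ge0 (cx p); have h2 := sqr_ge0 (cy p); have h3 := sqr_ge0 (cz p).
by split; rewrite -ler_norml (le_trans _ pr)// -(ler_pXn2r (n := 2)) ?nnegrE ?sqrtr_ge0//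
  norm3_sqr real_normK ?num_real//; lra.
Qed.

End CkCalculus.

Section DriftMeasurable.
Variables (R : realType) (mu lam e : R).
Local Notation pt3 := (pt3 R).
Implicit Types (a b : pt3 -> cplx R).

Definition cmeasurable a :=
  measurable_fun [set: pt3] (fun p => (a p).1) /\ measurable_fun [set: pt3] (fun p => (a p).2).

Lemma cmeasurable_pair (f g : pt3 -> R) : measurable_fun [set: pt3] f ->
  measurable_fun [set: pt3] g -> cmeasurable (fun p => (f p, g p)).
Proof. by []. Qed.

Lemma cmeasurable_cst (z : cplx R) : cmeasurable (fun=> z).
Proof. by split; exact: measurable_cst. Qed.

Lemma cmeasurable_add a b : cmeasurable a -> cmeasurable b ->
  cmeasurable (fun p => Defs.cadd (a p) (b p)).
Proof. by move=> [? ?] [? ?]; split; exact: measurable_funD. Qed.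

Lemma cmeasurable_sub a b : cmeasurable a -> cmeasurable b ->
  cmeasurable (fun p => csub (a p) (b p)).
Proof. by move=> [? ?] [? ?]; split; exact: measurable_funB. Qed.

Lemma cmeasurable_mul a b : cmeasurable a -> cmeasurable b ->
  cmeasurable (fun p => cmul (a p) (b p)).
Proof.
move=> [? ?] [? ?]; split.
  by apply: measurable_funB; exact: measurable_funM.
by apply: measurable_funD; exact: measurable_funM.
Qed.

Lemma measurable_fun_inv (f : pt3 -> R) : measurable_fun [set: pt3] f ->
  measurable_fun [set: pt3] (fun p => (f p)^-1).
Proof. by move=> mf; apply: measurableT_comp mf; exact: measurable_invr. Qed.

Lemma measurable_fun_sqrt (f : pt3 -> R) : measurable_fun [set: pt3] f ->
  measurable_fun [set: pt3] (fun p => Num.sqrt (f p)).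
Proof. by move=> mf; apply: measurableT_comp mf; exact: measurable_sqrt. Qed.

Lemma measurable_cabs a : cmeasurable a -> measurable_fun [set: pt3] (fun p => cabs (a p)).
Proof.
move=> [? ?]; apply: measurable_fun_sqrt.
by apply: measurable_funD; exact: measurable_funX.
Qed.

Lemma cmeasurable_inv a : cmeasurable a -> cmeasurable (fun p => cinv (a p)).
Proof.
move=> [m1 m2]; have m : measurable_fun [set: pt3] (fun p => ((a p).1 ^+ 2 + (a p).2 ^+ 2)^-1).
  by apply: measurable_fun_inv; apply: measurable_funD; exact: measurable_funX.
by split; apply: measurable_funM => //; exact: measurable_funN.
Qed.

Lemma cmeasurable_sqrt a : cmeasurable a -> cmeasurable (fun p => csqrt (a p)).
Proof.
move=> ma; have mc := measurable_cabs ma; have [m1 m2] := ma; split => /=.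
  by apply: measurable_fun_sqrt; apply: measurable_funM => //; exact: measurable_funD.
apply: measurable_funM; last first.
  by apply: measurable_fun_sqrt; apply: measurable_funM => //; exact: measurable_funB.
by apply: measurable_fun_ifT => //; apply: measurable_fun_ltr.
Qed.

Lemma measurable_coord3 i : measurable_fun [set: pt3] (fun p => coord3 p i).
Proof.
by case: i => [|[|i]]; apply: continuous_measurable3;
  [exact: continuous_cx|exact: continuous_cy|exact: continuous_cz].
Qed.

Lemma measurable_norm3 : measurable_fun [set: pt3] (@norm3 R).
Proof.
apply: measurable_fun_sqrt; apply: measurable_funD; last first.
  by apply: measurable_funX; exact: (measurable_coord3 2).
by apply: measurable_funD; apply: measurable_funX;
  [exact: (measurable_coord3 0)|exact: (measurable_coord3 1)].
Qed.

Lemma cmeasurable_nu : cmeasurable (nu mu lam e).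
Proof.
apply: cmeasurable_pair.
  apply: measurable_funM => //; apply: measurable_funB; first exact: measurable_norm3.
  by apply: measurable_funM => //; exact: (measurable_coord3 0).
apply: measurable_funN; apply: measurable_funM => //; apply: measurable_funM => //.
by apply: measurable_funM => //; exact: (measurable_coord3 1).
Qed.

Lemma cmeasurable_sq : cmeasurable (sq mu lam e).
Proof.
apply: cmeasurable_sqrt; apply: cmeasurable_sub; first exact: cmeasurable_cst.
apply: cmeasurable_mul; first exact: cmeasurable_cst.
exact: cmeasurable_inv cmeasurable_nu.
Qed.

Lemma measurable_Reps eps : measurable_fun [set: pt3] (Reps mu lam e eps).
Proof.
have mln (f : pt3 -> R) : measurable_fun [set: pt3] f ->
    measurable_fun [set: pt3] (fun p => ln (f p)).
  by move=> mf; apply: measurableT_comp mf; exact: measurable_ln.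
apply: measurable_funM => //; apply: measurable_funD; last first.
  apply: measurable_funM => //.
  have [+ _] := cmeasurable_mul cmeasurable_nu
    (cmeasurable_sub (cmeasurable_cst (creal 1)) cmeasurable_sq); exact.
apply: measurable_funB; last first.
  apply: measurable_funM => //; apply: measurable_funM => //; exact: measurable_norm3.
apply: measurable_funD; first by apply: mln; apply: measurable_cabs; exact: cmeasurable_nu.
apply: measurable_funM => //; apply: mln; apply: measurable_cabs.
exact: cmeasurable_add (cmeasurable_cst _) cmeasurable_sq.
Qed.

Lemma measurable_drift i : measurable_fun [set: pt3] (drift mu lam e i).
Proof.
suff [m1 m2] : cmeasurable (Zc mu lam e i) by exact: measurable_funB.
apply: cmeasurable_add; apply: cmeasurable_mul.
- apply: cmeasurable_mul; first exact: cmeasurable_cst.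
  exact: cmeasurable_add (cmeasurable_cst _) cmeasurable_sq.
- apply: cmeasurable_pair => //; apply: measurable_funM; first exact: measurable_coord3.
  exact: measurable_fun_inv measurable_norm3.
- apply: cmeasurable_mul; first exact: cmeasurable_cst.
  exact: cmeasurable_sub (cmeasurable_cst _) cmeasurable_sq.
- exact: cmeasurable_cst.
Qed.

End DriftMeasurable.

(** * The spectral gap *)


Section Gap.
Variables (R : realType) (mu lam e : R).
Local Notation pt3 := (pt3 R).
Local Notation leb3 := (@leb3 R).

Definition grad_sqr (f : pt3 -> R) (p : pt3) : R :=
  pdiff 0 f p ^+ 2 + pdiff 1 f p ^+ 2 + pdiff 2 f p ^+ 2.

Lemma grad_sqr_ge0 f p : 0 <= grad_sqr f p.
Proof. by rewrite !addr_ge0 ?sqr_ge0. Qed.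

Lemma continuous_grad_sqr f : Ck 1 f -> continuous (grad_sqr f).
Proof.
move=> Cf; have c i : dir3 i -> continuous (pdiff i f).
  by move=> di; exact: Ck_continuous (Ck_pdiff Cf di).
by apply: continuous_addf; [apply: continuous_addf|]; apply: continuous_sqr; exact: c.
Qed.

Lemma continuous_norm3 : continuous (@norm3 R).
Proof.
move=> p; apply: (@continuous_comp _ _ _ (fun p : pt3 => cx p ^+ 2 + cy p ^+ 2 + cz p ^+ 2)
  (@Num.sqrt R)); last exact: sqrt_continuous.
move: p; apply: continuous_addf; last exact: (continuous_sqr (@continuous_cz R)).
by apply: continuous_addf; apply: continuous_sqr; [exact: continuous_cx|exact: continuous_cy].
Qed.

Lemma pdiff_off_support f (r : R) i p : (forall q, r < norm3 q -> f q = 0) -> r < norm3 p ->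
  pdiff i f p = 0.
Proof.
move=> Hr rp; rewrite /pdiff derive1E.
have cl : continuous (fun t => norm3 (upd3 p i t)).
  case: p {rp} => [[x y] z]; case: i => [|[|i]].
  - exact: (continuous_line0 continuous_norm3).
  - exact: (continuous_line1 continuous_norm3).
  - exact: (continuous_line2 continuous_norm3).
have near0 : \forall t \near coord3 p i, f (upd3 p i t) = cst 0 t.
  have : \forall t \near coord3 p i, r < norm3 (upd3 p i t).
    by apply: (cvgr_gt _ (cl _)); rewrite upd3_coord3.
  by apply: filterS => t /Hr ->.
by rewrite (near_eq_derive _ near0) ?derive_cst.
Qed.

Lemma compact_support_grad_sqr (f : pt3 -> R) : compact_support f -> compact_support (grad_sqr f).
Proof.
move=> [r Hr]; exists r => p rp; rewrite /grad_sqr !(pdiff_off_support _ Hr rp).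
by rewrite expr0n /= !addr0.
Qed.

Section FixedEps.
Variables (eps : R) (T : pt3 -> R).
Hypotheses (CT : Ck 2 T) (T0 : forall p, 0 < T p)
  (Zfin : (Zconst mu lam e eps T < +oo)%E) (inv : pi_invariant mu lam e eps T).
Local Notation rho := (rho mu lam e eps T).

Lemma dens_un_gt0 p : 0 < dens_un mu lam e eps T p.
Proof. by rewrite mulr_gt0 ?expR_gt0. Qed.

Lemma measurable_dens_un : measurable_fun [set: pt3] (dens_un mu lam e eps T).
Proof.
apply: measurable_funM; first exact: continuous_measurable3 (Ck_continuous CT).
have m : measurable_fun [set: pt3] (fun p => 2 * Reps mu lam e eps p).
  by apply: measurable_funM => //; exact: measurable_Reps.
by apply: measurableT_comp m; exact: measurable_expR.
Qed.

Lemma measurable_rho : measurable_fun [set: pt3] rho.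
Proof. by apply: measurable_funM => //; exact: measurable_dens_un. Qed.

Lemma fine_Zconst_ge0 : 0 <= fine (Zconst mu lam e eps T).
Proof. by apply: fine_ge0; apply: integral_ge0_EFin => p _; rewrite ltW// dens_un_gt0. Qed.

Lemma rho_ge0 p : 0 <= rho p.
Proof. by apply: divr_ge0; [rewrite ltW// dens_un_gt0|exact: fine_Zconst_ge0]. Qed.

Lemma integrable_rho : leb3.-integrable setT (fun p => (rho p)%:E).
Proof.
have H : leb3.-integrable setT (fun p => (dens_un mu lam e eps T p)%:E).
  apply/integrableP; split; first by apply/measurable_EFinP; exact: measurable_dens_un.
  rewrite (_ : (fun _ => _) = (fun p => (dens_un mu lam e eps T p)%:E)) //.
  by apply/funext => p /=; rewrite ger0_norm// ltW// dens_un_gt0.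
have := integrableZr measurableT (fine (Zconst mu lam e eps T))^-1 H.
by apply: eq_integrable.
Qed.

Lemma integrable_bounded_rho (h : pt3 -> R) (B : R) : measurable_fun [set: pt3] h ->
  (forall p, `|h p| <= B) -> leb3.-integrable setT (fun p => (h p * rho p)%:E).
Proof.
move=> mh hB; have iB := integrableZl measurableT B integrable_rho.
apply: (le_integrable measurableT _ _ iB).
- by apply/measurable_EFinP; apply: measurable_funM => //; exact: measurable_rho.
- move=> p _ /=; rewrite lee_fin !normrM ler_wpM2r//.
  exact: le_trans (hB p) (ler_norm _).
Qed.

Lemma dirichlet_form f : Ccinf f ->
  int_pi mu lam e eps T (fun p => f p * gen mu lam e eps f p) =
  (- ((eps ^+ 2 / 2)%:E * int_pi mu lam e eps T (grad_sqr f)))%E.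
Proof.
move=> Ccf; have [Cf sf] := Ccf; have C2 := Cf 2%N; have C1 := Cf 1%N.
have [_ /(_ _ (Ccinf_mul Ccf Ccf)) H0] := inv.
have cpd i : dir3 i -> continuous (pdiff i f).
  by move=> di; exact: Ck_continuous (Ck_pdiff C1 di).
have cpdd i : dir3 i -> continuous (pdiffs [:: i; i] f).
  by move=> di; exact: Ck_continuous (Ck_pdiff (Ck_pdiff C2 di) di).
have mf : measurable_fun [set: pt3] f by exact: continuous_measurable3 (Ck_continuous C1).
have mpd i : dir3 i -> measurable_fun [set: pt3] (pdiff i f).
  by move=> di; exact: continuous_measurable3 (cpd _ di).
have mpdd i : dir3 i -> measurable_fun [set: pt3] (pdiffs [:: i; i] f).
  by move=> di; exact: continuous_measurable3 (cpdd _ di).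
have mgen : measurable_fun [set: pt3] (gen mu lam e eps f).
  apply: measurable_funD.
    apply: measurable_funM => //; apply: measurable_funD; last exact: mpdd.
    by apply: measurable_funD; exact: mpdd.
  apply: measurable_funD; last by apply: measurable_funM; [exact: measurable_drift|exact: mpd].
  by apply: measurable_funD; apply: measurable_funM;
    [exact: measurable_drift|exact: mpd|exact: measurable_drift|exact: mpd].
pose h1 p := f p * gen mu lam e eps f p * rho p.
pose h2 p := grad_sqr f p * rho p.
(* This is the integrand of the invariance identity tested on [f^2], by
   [G (f^2) = 2 f G f + eps^2 |grad f|^2]. *)
pose h p := 2 * h1 p + eps ^+ 2 * h2 p.
have mh1 : measurable_fun [set: pt3] h1.
  by apply: measurable_funM; [exact: measurable_funM|exact: measurable_rho].
have mg : measurable_fun [set: pt3] (grad_sqr f).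
  exact: continuous_measurable3 (continuous_grad_sqr C1).
have mh2 : measurable_fun [set: pt3] h2 by apply: measurable_funM => //; exact: measurable_rho.
have mh : measurable_fun [set: pt3] h by apply: measurable_funD; exact: measurable_funM.
have Ih : (\int[leb3]_p (h p)%:E = 0)%E.
  rewrite -[RHS]H0; apply: eq_integral => p _; congr EFin.
  have L i : dir3 i -> _ := @pdiff2_sqr R f i p C2.
  have S i (di : dir3 i) : pdiff i (fun q => f q * f q) p = f p * pdiff i f p + f p * pdiff i f p.
    by rewrite (pdiff_sqr C1 di).
  have E : laplacian (fun q => f q * f q) p = 2 * (f p * laplacian f p) + 2 * grad_sqr f p.
    rewrite [LHS]/laplacian (L 0%N isT) (L 1%N isT) (L 2%N isT) /laplacian /grad_sqr.
    by move: (pdiffs _ _ _) (pdiffs _ _ _) (pdiffs _ _ _) (pdiff _ _ _) (pdiff _ _ _)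
      (pdiff _ _ _) => *; ring.
  rewrite E (S 0%N isT) (S 1%N isT) (S 2%N isT) /h /h1 /h2 /gen.
  move: (rho p) (laplacian f p) (grad_sqr f p) (pdiff 0 f p) (pdiff 1 f p) (pdiff 2 f p)
    (drift _ _ _ _ _) (drift _ _ _ _ _) (drift _ _ _ _ _) => *; by field.
(* The drift is not bounded, so [h1] is not estimated directly. Invariance gives [h] the integral 0,
   and a finite integral forces integrability; [h1] is then recovered from [h] and the
   bounded-times-[rho] term [h2]. *)
have ih : leb3.-integrable setT (fun p => (h p)%:E).
  apply/integrableP; split; first exact/measurable_EFinP.
  have := integral_fin_num_abs leb3 measurableT mh; rewrite Ih => E.
  by rewrite E.
have [B HB] := compact_support_bounded (continuous_grad_sqr C1) (compact_support_grad_sqr sf).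
have ih2 : leb3.-integrable setT (fun p => (h2 p)%:E) by exact: integrable_bounded_rho HB.
have E1 : (\int[leb3]_p (h1 p)%:E =
  \int[leb3]_p ((2^-1)%:E * ((h p)%:E - (eps ^+ 2)%:E * (h2 p)%:E)))%E.
  apply: eq_integral => p _.
  have -> : h1 p = 2^-1 * (h p - eps ^+ 2 * h2 p) by rewrite /h; field.
  by [].
rewrite /int_pi -/h1 E1.
have ie : leb3.-integrable setT (fun p => ((eps ^+ 2)%:E * (h2 p)%:E)%E).
  exact: integrableZl.
rewrite integralZl//; last exact: integrableB.
rewrite integralB// Ih sub0e integralZl// muleN muleA -EFinM.
by rewrite mulrC.
Qed.

(** The [c] supplied by the cube is not the mean of [f] under [pi]; since that mean is 0, the cross
    term vanishes and centring at [c] can only increase the second moment. *)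
Lemma variance_le (f : pt3 -> R) (c : R) : Ccinf f ->
  int_pi mu lam e eps T f = 0%E -> int_pi mu lam e eps T (fun p => f p ^+ 2) = 1%E ->
  (1 <= int_pi mu lam e eps T (fun p => ((f p - c) ^+ 2)%R))%E.
Proof.
move=> [Cf sf] H0 H1; have cf := Ck_continuous (Cf 0%N).
have [B HB] := compact_support_bounded cf sf.
have mf := continuous_measurable3 cf.
have i1 := integrable_bounded_rho mf HB.
have i2 : leb3.-integrable setT (fun p => (f p ^+ 2 * rho p)%:E).
  apply: (@integrable_bounded_rho _ (B ^+ 2)); first exact: measurable_funX.
  by move=> p; rewrite normrX lerXn2r ?nnegrE// (le_trans _ (HB p)).
have E : int_pi mu lam e eps T (fun p => (f p - c) ^+ 2) =
   (\int[leb3]_p ((f p ^+ 2 * rho p)%:E + (- (2 * c))%:E * (f p * rho p)%:E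
      + (c ^+ 2)%:E * (rho p)%:E))%E.
  apply: eq_integral => p _; rewrite -!EFinM -!EFinD; congr EFin; ring.
have i3 : leb3.-integrable setT (fun p => ((- (2 * c))%:E * (f p * rho p)%:E)%E).
  exact: integrableZl.
have i4 : leb3.-integrable setT (fun p => ((c ^+ 2)%:E * (rho p)%:E)%E).
  exact: integrableZl integrable_rho.
have i23 : leb3.-integrable setT
    (fun p => ((f p ^+ 2 * rho p)%:E + (- (2 * c))%:E * (f p * rho p)%:E)%E).
  exact: integrableD.
rewrite E integralD// integralD// !integralZl//; last exact: integrable_rho.
have -> : (\int[leb3]_p (f p * rho p)%:E)%E = 0%E by exact: H0.
have -> : (\int[leb3]_p (f p ^+ 2 * rho p)%:E)%E = 1%E by exact: H1.
rewrite mule0 adde0 leeDl// mule_ge0 ?lee_fin ?sqr_ge0//.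
by apply: integral_ge0_EFin => p _; exact: rho_ge0.
Qed.

(** Were the normalising constant 0, division by zero would make [rho] vanish identically, and no
    function could have integral 1. Positivity is thus read off from the constraint on the test
    function. *)
Lemma fine_Zconst_gt0 (g : pt3 -> R) : int_pi mu lam e eps T g = 1%E ->
  0 < fine (Zconst mu lam e eps T).
Proof.
move=> H; rewrite lt_neqAle fine_Zconst_ge0 andbT; apply/eqP => z0.
move: H; rewrite /int_pi (_ : (fun _ => _) = cst 0%E).
  by rewrite integral0 => /eqP; rewrite eqe eq_sym oner_eq0.
by apply/funext => p /=; rewrite /Defs.rho -z0 invr0 !mulr0.
Qed.

(* Holley-Stroock: the density is within [exp (m + c n)] of the smooth weight. *)
Lemma poincare_rho (m c A : R) (f f0 : pt3 -> R) (k : R) :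
  (forall p, `|ln (T p)| <= m) ->
  (forall p, `|2 * Reps mu lam e eps p - potential mu lam e p / eps ^+ 2| <= c / eps ^+ 2) ->
  0 < fine (Zconst mu lam e eps T) -> 0 <= A ->
  continuous f -> continuous f0 ->
  (\int[leb3]_p ((f p - k) ^+ 2 * weight mu lam e (eps ^+ 2)^-1 p)%:E <= A%:E *
     \int[leb3]_p (f0 p * weight mu lam e (eps ^+ 2)^-1 p)%:E)%E ->
  (forall p, 0 <= f0 p) ->
  (int_pi mu lam e eps T (fun p => ((f p - k) ^+ 2)%R) <=
    (A * expR (2 * (m + c / eps ^+ 2)))%:E * int_pi mu lam e eps T f0)%E.
Proof.
move=> Hm Hc z0 A0 cf cf0 H f00.
set w := weight mu lam e _ in H *; set D := m + c / eps ^+ 2; set z := fine _ in z0.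
have w0 p : 0 <= w p by exact: expR_ge0.
have dw p : expR (- D) * w p <= dens_un mu lam e eps T p <= expR D * w p.
  rewrite /dens_un -[T p](@lnK R) ?posrE// -expRD /w /weight -!expRD !ler_expR.
  have := Hm p; have := Hc p; rewrite !ler_norml => /andP[h1 h2] /andP[h3 h4].
  by rewrite [_^-1 * _]mulrC /D; apply/andP; split; lra.
have mw : measurable_fun [set: pt3] w.
  by apply: continuous_measurable3; exact: continuous_weight.
have mg : measurable_fun [set: pt3] (fun p => (f p - k) ^+ 2).
  by apply: measurable_funX; apply: measurable_funB => //; exact: continuous_measurable3.
have mf0 : measurable_fun [set: pt3] f0 by exact: continuous_measurable3.
have mr := measurable_rho; have iz0 : 0 < z^-1 by rewrite invr_gt0.
have c1 : 0 <= expR D / z by rewrite mulr_ge0 ?expR_ge0// ltW.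
have c2 : 0 <= z * expR D by rewrite mulr_ge0 ?expR_ge0// ltW.
apply: (@le_trans _ _ ((expR D / z)%:E * \int[leb3]_p ((f p - k) ^+ 2 * w p)%:E)%E).
  rewrite /int_pi -integralZ_EFin//; last 2 first.
  - exact: measurable_funM.
  - by move=> p _; rewrite mulr_ge0 ?sqr_ge0.
  apply: integral_le_EFin => //.
  - exact: measurable_funM.
  - by apply: measurable_funM => //; exact: measurable_funM.
  - by move=> p _; rewrite mulr_ge0 ?sqr_ge0 ?rho_ge0.
  - move=> p _; rewrite [leRHS]mulrCA; apply: ler_wpM2l; first exact: sqr_ge0.
    rewrite /Defs.rho -/z [leRHS]mulrAC; apply: ler_wpM2r; first exact: ltW.
    by have /andP[] := dw p.
apply: le_trans (lee_wpmul2l _ H) _; first by rewrite lee_fin.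
have -> : A * expR (2 * D) = (expR D / z) * (A * (z * expR D)).
  by rewrite (_ : 2 * D = D + D) ?expRD; [field; rewrite gt_eqF|ring].
rewrite (EFinM (_ / _)) -muleA; apply: lee_wpmul2l; first by rewrite lee_fin.
rewrite (EFinM A) -muleA; apply: lee_wpmul2l; first by rewrite lee_fin.
rewrite /int_pi -integralZ_EFin//; last 2 first.
- exact: measurable_funM.
- by move=> p _; rewrite mulr_ge0 ?rho_ge0.
apply: integral_le_EFin => //.
- exact: measurable_funM.
- by apply: measurable_funM => //; exact: measurable_funM.
- by move=> p _; rewrite mulr_ge0.
- move=> p _; rewrite [leRHS]mulrCA; apply: ler_wpM2l => //.
  have -> : z * expR D * rho p = expR D * dens_un mu lam e eps T p.
    by rewrite /Defs.rho -/z; field; rewrite gt_eqF.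
  rewrite -[w p]mul1r -(expR0 R) -(subrr D) expRD -mulrA ler_pM2l ?expR_gt0//.
  by have /andP[] := dw p.
Qed.

End FixedEps.
End Gap.

(** The origin of [gamma], with [n = 1/eps^2] and right-hand side [eps^2/2]: the summand [A] pays
    for [A <= exp(A n)], the 3 for [2 n <= exp(3 n)], and [2 m] suffices because [m <= m n]; [b] and
    [2 c] match their exponents exactly. *)
Lemma exp_constant_le (R : realType) (A m c b n : R) : 0 < A -> 0 <= m -> 0 <= c -> 0 <= b ->
  1 <= n -> expR (- (3 + A + 2 * m + 2 * c + b) * n) * (A * expR (b * n) * expR (2 * (m + c * n)))
     <= (2 * n)^-1.
Proof.
move=> A0 m0 c0 b0 n1; have n0 : 0 < n by lra.
rewrite -mulrA -expRD mulrCA -expRD -[leRHS]mul1r ler_pdivlMr ?mulr_gt0//.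
have hA : A <= expR (A * n).
  apply: (@le_trans _ _ (A * n)); first by rewrite ler_pMr.
  by have := expR_ge1Dx (A * n); lra.
have h2n : 2 * n <= expR (3 * n) by have := expR_ge1Dx (3 * n); lra.
apply: (@le_trans _ _ (expR (A * n) * expR (- (3 + A + 2 * m + 2 * c + b) * n +
   (b * n + 2 * (m + c * n))) * expR (3 * n))).
  apply: ler_pM => //; try lra.
  - by rewrite mulr_ge0 ?expR_ge0// ltW.
  - by rewrite ler_wpM2r ?expR_ge0.
rewrite -!expRD -[leRHS](expR0 R) ler_expR.
have mn : m <= m * n by rewrite ler_peMr.
rewrite (_ : _ + 3 * n = 2 * (m - m * n)); last by ring.
by rewrite mulr_ge0_le0// subr_le0.
Qed.



Theorem theorem7p9 (R : realType) (mu lam e C r0 M : R) :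
  0 < mu -> 0 < lam -> 0 < e < 1 -> 0 < r0 -> 0 < C < mu / lam ->
  exists gamma : R, 0 < gamma /\
  forall T : R -> pt3 R -> R,
    (* T_eps in C^2(R^3; (0, oo)) for eps in (0,1] *)
    (forall eps, 0 < eps <= 1 -> Ck 2 (T eps) /\ forall p, 0 < T eps p) ->
    (* M = sup_eps sup_x |ln T_eps(x)| (finite) *)
    (forall eps p, 0 < eps <= 1 -> `|ln (T eps p)| <= M) ->
    (forall M' : R, (forall eps p, 0 < eps <= 1 -> `|ln (T eps p)| <= M') -> M <= M') ->
    (* |grad ln T_eps(x)| < C for |x| > r0 *)
    (forall eps p, 0 < eps <= 1 -> r0 < norm3 p ->
       grad_norm (fun q => ln (T eps q)) p < C) ->
    (* pi_eps is a (normalizable) probability density, invariant for the diffusion *)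
    (forall eps, 0 < eps <= 1 -> (Zconst mu lam e eps (T eps) < +oo)%E) ->
    (forall eps, 0 < eps <= 1 -> pi_invariant mu lam e eps (T eps)) ->
    forall eps, 0 < eps <= 1 ->
      ((expR (- gamma / eps ^+ 2))%:E <= gap mu lam e eps (T eps))%E.
Proof.
move=> mu0 lam0 e01 _ _.
have [c c0 Hc] := Reps_near_potential e mu0 lam0.
have [A [b [A0 b0 HP]]] := global_poincare mu0 lam0 e01.
(* [gamma] is fixed before any [T] is given, when the sign of [M] is still unknown; hence the
   absolute value. *)
exists (3 + A + 2 * `|M| + 2 * c + b); split.
  by have := normr_ge0 M; lra.
move=> T HT HM _ _ HZ Hinv eps eps01; have [eps0 eps1] := andP eps01.
have [CT T0] := HT eps eps01.
have n1 : 1 <= (eps ^+ 2)^-1.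
  by rewrite invf_ge1 ?exprn_gt0// expr_le1// ltW.
apply: le_ereal_inf_tmp => _ [f [Ccf H0 H1 ->]].
have [Cf sf] := Ccf; have C1 := Cf 1%N.
rewrite (dirichlet_form CT T0 (HZ _ eps01) (Hinv _ eps01) Ccf) oppeK.
have cpd i : dir3 i -> continuous (pdiff i f).
  by move=> di; exact: Ck_continuous (Ck_pdiff C1 di).
have [k Hk] := HP _ f _ _ _ n1 (C1lines_pdiff C1) (Ck_continuous C1)
  (cpd 0%N isT) (cpd 1%N isT) (cpd 2%N isT).
have Hm p : `|ln (T eps p)| <= `|M|.
  by apply: le_trans (HM eps p eps01) _; exact: ler_norm.
have A1 : 0 <= A * expR (b / eps ^+ 2) by rewrite mulr_ge0 ?expR_ge0// ltW.
have z0 := fine_Zconst_gt0 T0 H1.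
have := poincare_rho CT T0 Hm (fun p => Hc eps p eps0)
  z0 A1 (Ck_continuous C1) (continuous_grad_sqr C1) Hk (grad_sqr_ge0 f).
move=> /(le_trans (variance_le CT T0 (HZ _ eps01) k Ccf H0 H1)).
set X := int_pi _ _ _ _ _ (grad_sqr f).
have X0 : (0 <= X)%E.
  apply: integral_ge0_EFin => p _; rewrite mulr_ge0 ?grad_sqr_ge0//.
  exact: rho_ge0.
set D := A * _ * _ => HX.
have key := exp_constant_le A0 (normr_ge0 M) c0 b0 n1.
set g := expR _ in key *.
(* Multiplying [1 <= D X] by [g = exp(-gamma n)] reduces the claim to [g D <= eps^2/2], the
   coefficient of the Dirichlet form. *)
apply: (@le_trans _ _ (g%:E * (D%:E * X))%E).
  by rewrite -[leLHS]mule1; apply: lee_wpmul2l => //; rewrite lee_fin expR_ge0.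
rewrite muleA -EFinM; apply: lee_wpmul2r => //; rewrite lee_fin.
apply: le_trans key _; rewrite invfM invrK mulrC.
by [].
Qed.
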